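(* Let $1<q<p$ be coprime integers and let $K(p,q,h)$ be a primitive Legendrian grid number one knot in $L(p,q)$ with associated vertical length $v$. When $\gcd(q-1,p)=1$, the Lagrangian projection $\Gamma\subset S^2$ of $K(p,q,h)$ (that is, of its representative $K_0$ with special front projection) has $h+v-1$ crossings, and there are $h+v+1$ connected components of $S^2-\Gamma$.
   Context: **Lens space and projections.** View $S^3=\{(r_1,\theta_1,r_2,\theta_2): r_1^2+r_2^2=1\}\subset\mathbb{C}^2$ (polar coordinates) with contact form $r_1^2d\theta_1+r_2^2d\theta_2$, and let $F_{p,q}(r_1,\theta_1,r_2,\theta_2)=(r_1,\theta_1+\frac{2\pi q}{p},r_2,\theta_2+\frac{2\pi}{p})$. Then $L(p,q)=S^3/\langle F_{p,q}\rangle$ with the induced contact form; for $0<r_1<1$ the Reeb field is $\partial_{\theta_1}+\partial_{\theta_2}$. The Heegaard torus $\Sigma$ is the image of $r_1=r_2=1/\sqrt2$; it is parametrized by $0\le\theta_1<2\pi$ (mod $2\pi$), $0\le\theta_2\le\frac{2\pi}{p}$, with $(\theta_1,0)\sim(\theta_1+\frac{2\pi q}{p},\frac{2\pi}{p})$, and is divided into boxes: Box $c$ is $\frac{2\pi c}{p}\le\theta_1\le\frac{2\pi(c+1)}{p}$, $c=0,\dots,p-1$. Knots lie in the complement of the core curves $r_1=0$ and $r_2=0$. The front projection is the projection to $\Sigma$ along $r_1$; a Legendrian knot is recovered from its front by $\frac{d\theta_2}{d\theta_1}=\frac{-r_1^2}{1-r_1^2}$. The Lagrangian projection is the map to the space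 of Reeb orbits of $L(p,q)$, a sphere $S^2$ with latitude $r_1\in[0,1]$ and azimuth $\phi=\frac pk(\theta_1-\theta_2)$ mod $2\pi$, $k=\gcd(q-1,p)$. **The special knot.** A grid number one diagram is the row of $p$ boxes with a basepoint in two of them. If the basepoints are $s$ boxes apart, $v(s)$ is the integer with $s+v(s)q\equiv 0\bmod p$, $1\le v(s)\le p-1$; put $h=s$ if $s+v(s)<p$, $h=p-s$ if $s+v(s)>p$, and $v=v(h)$ (so $h+v<p$). $K(p,q,h)$ is primitive (generates $H_1(L(p,q))$) iff $\gcd(h,p)=1$. $K(p,q,h)$ is the Legendrian isotopy class of the following special knot $K_0$. Place basepoints at the centers of Box $0$ and Box $h$; connect them by a horizontal line running right from Box $0$ with length $h$ boxes, then by a vertical line running down from Box $h$ with length $v$ boxes back to Box $0$. Add a basepoint at every box center the curve passes through, so that the curve consists of $h+v$ segments of equal length. Slide each basepoint slightly along the anti-diagonal of its box (the slope $1$ diagonal, on which $\theta_1-\theta_2$ is constant) so that the slopes of the $h+v$ straight segments are negative and strictly decrease as one moves along the curve starting rightward from Box $0$. Finally replace a small neighborhood of each basepoint by a curve interpolating smoothly and strictly monotonically between the two adjacent slopes. All perturbations are sufficiently small. This is a special front projection and $K_0$ is the Legendrian knot with this front. *)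

(* Defs.v *)
From HB Require Import structures.
From mathcomp Require Import all_boot all_order all_algebra.
From mathcomp Require Import all_classical all_reals all_analysis.
From mathcomp Require Import complex.
From mathcomp Require Import ring lra.

Set Implicit Arguments.
Unset Strict Implicit.
Unset Printing Implicit Defensive.

Import Order.TTheory GRing.Theory Num.Theory.
Import numFieldNormedType.Exports.

Local Open Scope classical_set_scope.
Local Open Scope ring_scope.

(* Polar coordinates (r1, theta1, r2, theta2) on C^2; a point of C^2 has many
   of them, [toC2] gives the point itself. *)
Record polar (R : realType) := Polar { r1 : R; th1 : R; r2 : R; th2 : R }.

Arguments r1 {R}.
Arguments th1 {R}.
Arguments r2 {R}.
Arguments th2 {R}.

Definition on_S3 (R : realType) (x : polar R) : Prop :=
  [/\ 0 <= r1 x, 0 <= r2 x & r1 x ^+ 2 + r2 x ^+ 2 = 1].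

Definition toC2 (R : realType) (x : polar R) : R[i] * R[i] :=
  (Complex (r1 x * cos (th1 x)) (r1 x * sin (th1 x)),
   Complex (r2 x * cos (th2 x)) (r2 x * sin (th2 x))).

Definition deck (R : realType) (p q : nat) (x : polar R) : polar R :=
  Polar (r1 x) (th1 x + 2 * pi * q%:R / p%:R)
        (r2 x) (th2 x + 2 * pi / p%:R).

(* A point of L(p,q) is a <F_{p,q}>-orbit in S^3; as F_{p,q} has order p, the
   nonnegative powers exhaust the group. *)
Definition lens_pt (R : realType) (p q : nat) (x : polar R) :
    set (R[i] * R[i]) :=
  [set toC2 (iter j (deck p q) x) | j in [set: nat]].

Definition lens_space (R : realType) (p q : nat) : set (set (R[i] * R[i])) :=
  [set lens_pt p q x | x in [set x : polar R | on_S3 x]].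

Definition S2 (R : realType) : set (R * R * R) :=
  [set y | y.1.1 ^+ 2 + y.1.2 ^+ 2 + y.2 ^+ 2 = 1].

(* The azimuth p/k (theta1 - theta2), k = gcd(q-1,p). *)
Definition azimuth (R : realType) (p q : nat) (x : polar R) : R :=
  (p %/ gcdn (q - 1) p)%:R * (th1 x - th2 x).

(* The point of the unit sphere with azimuth phi on the parallel indexed by r1:
   as in the Hopf map, r1 in [0,1] is the latitude coordinate through
   height r1^2 - r2^2, so r1 = 0 and r1 = 1 are the poles. *)
Definition lag_pt (R : realType) (p q : nat) (x : polar R) : R * R * R :=
  (2 * r1 x * r2 x * cos (azimuth p q x),
   2 * r1 x * r2 x * sin (azimuth p q x),
   r1 x ^+ 2 - r2 x ^+ 2).

(* Independent of the representative [x] of P: see [lagE]. *)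
Definition lag (R : realType) (p q : nat) (P : set (R[i] * R[i])) : R * R * R :=
  xget (0, 0, 0)
    [set lag_pt p q x | x in [set x | on_S3 x /\ lens_pt p q x = P]].

Lemma iter_deck (R : realType) (p q j : nat) (x : polar R) :
  iter j (deck p q) x = Polar (r1 x) (th1 x + j%:R * (2 * pi * q%:R / p%:R))
                              (r2 x) (th2 x + j%:R * (2 * pi / p%:R)).
Proof.
elim: j => [|j IHj] /=; first by rewrite !mul0r !addr0; case: x.
by rewrite IHj /deck /= -!addrA -[j.+1]addn1 natrD !mulrDl !mul1r.
Qed.

Lemma lag_pt_lens (R : realType) (p q : nat) (x y : polar R) :
  (0 < p)%N -> (0 < q)%N -> on_S3 x -> on_S3 y ->
  lens_pt p q x = lens_pt p q y -> lag_pt p q x = lag_pt p q y.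
Proof.
move=> p0 q0 [x1 x2 _] [y1 y2 _] xy.
have : lens_pt p q x (toC2 x) by exists 0%N.
rewrite xy => -[j _]; rewrite iter_deck; case: x y x1 x2 y1 y2 {xy} =>
  [a s b t] [a' s' b' t'] /= a0 b0 a'0 b'0 [e1 e2 e3 e4].
have norm_inj (u w A B : R) : 0 <= u -> 0 <= w ->
    w * cos B = u * cos A -> w * sin B = u * sin A -> u = w.
  move=> u0 w0 eC eS.
  have : u ^+ 2 = w ^+ 2.
    by rewrite -[u ^+ 2]mulr1 -[w ^+ 2]mulr1 -{1}(cos2Dsin2 A) -(cos2Dsin2 B)
      !mulrDr -!exprMn eC eS.
  by move=> /eqP; rewrite eqrXn2// => /eqP.
have ea := norm_inj _ _ _ _ a0 a'0 e1 e2; have eb := norm_inj _ _ _ _ b0 b'0 e3 e4.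
subst a' b'; rewrite /lag_pt /=.
have [->|aN0] := eqVneq a 0; first by rewrite !(mulr0, mul0r).
have [->|bN0] := eqVneq b 0; first by rewrite !(mulr0, mul0r).
move: e1 e2 e3 e4 => /(mulfI aN0) e1 /(mulfI aN0) e2 /(mulfI bN0) e3 /(mulfI bN0) e4.
rewrite /azimuth /=; set m := (p %/ _)%N.
set S := s' + _ in e1 e2; set T := t' + _ in e3 e4.
have cs (n : nat) : cos (n%:R * (s - t)) = cos (n%:R * (S - T)) /\
                    sin (n%:R * (s - t)) = sin (n%:R * (S - T)).
  move: S T e1 e2 e3 e4 => S T e1 e2 e3 e4.
  have [ec es] : cos (s - t) = cos (S - T) /\ sin (s - t) = sin (S - T).
    by rewrite !cosB !sinB e1 e2 e3 e4.
  elim: n => [|n [IHc IHs]]; first by rewrite !mul0r.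
  rewrite -addn1 natrD [_ * (s - t)]mulrDl [_ * (S - T)]mulrDl !mul1r.
  by rewrite [cos (_ + (s - t))]cosD [sin (_ + (s - t))]sinD IHc IHs ec es
    -cosD -sinD.
have pk : (m * (q - 1) = p * ((q - 1) %/ gcdn (q - 1) p))%N.
  by rewrite mulnC muln_divCA_gcd.
have mST : m%:R * (S - T) =
    m%:R * (s' - t') + (pi *+ 2) *+ (j * ((q - 1) %/ gcdn (q - 1) p)).
  rewrite /S /T.
  have pn0 : (p%:R : R) != 0 by rewrite pnatr_eq0 -lt0n.
  have /(congr1 (fun k : nat => k%:R : R)) := pk.
  rewrite !natrM natrB// => pkR.
  rewrite -[_ *+ (j * _)]mulr_natl -[pi *+ 2]mulr_natl natrM.
  apply: (mulfI pn0); set r := (_ %/ _)%:R in pkR *.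
  transitivity (p%:R * m%:R * (s' - t') + j%:R * (2 * pi) * (m%:R * (q%:R - 1)));
    first by field.
  by rewrite pkR; ring.
have per n (z : R) : cos (z + (pi *+ 2) *+ n) = cos z /\
                     sin (z + (pi *+ 2) *+ n) = sin z.
  elim: n => [|n [IHc IHs]]; first by rewrite mulr0n addr0.
  by rewrite mulrSr addrA cosD2pi sinD2pi IHc IHs.
have [-> ->] := cs m; rewrite mST.
by have [-> ->] := per (j * ((q - 1) %/ gcdn (q - 1) p))%N (m%:R * (s' - t')).
Qed.

Lemma lagE (R : realType) (p q : nat) (x : polar R) :
  (0 < p)%N -> (0 < q)%N -> on_S3 x -> lag p q (lens_pt p q x) = lag_pt p q x.
Proof.
move=> p0 q0 Sx; rewrite /lag.
case: xgetP => [_ -> [y [Sy yx] <-]|/(_ (lag_pt p q x))].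
  exact: lag_pt_lens yx.
by case; exists x.
Qed.

(* All multiple points of the projection of K are double points, and there are
   exactly N of them. *)
Definition has_crossings (R : realType) (p q : nat)
    (K : set (set (R[i] * R[i]))) (N : nat) : Prop :=
  let fiber y := K `&` lag p q @^-1` [set y] in
  let multiple :=
    [set y | exists P Q, [/\ fiber y P, fiber y Q & P <> Q]] in
  (forall y, multiple y -> (fiber y #= `I_2)%card) /\ (multiple #= `I_N)%card.

Definition components (T : topologicalType) (A : set T) : set (set T) :=
  [set connected_component A x | x in A].

Definition vlen (p q s v : nat) : Prop :=
  (1 <= v <= p.-1)%N /\ (p %| s + v * q)%N.

(* h and v are the numbers attached to two basepoints s boxes apart. *)
Definition grid_one (p q h v : nat) : Prop :=
  exists s w : nat,
    [/\ (1 <= s <= p.-1)%N, vlen p q s w,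
        ((s + w < p)%N /\ h = s) \/ ((p < s + w)%N /\ h = (p - s)%N)
      & vlen p q h v].

(* K(p,q,h) generates H_1(L(p,q)) = Z/p exactly when gcd(h,p) = 1. *)
Definition primitive (p h : nat) : Prop := coprime h p.

(* In what follows, fronts are written in the universal cover R^2 of the Heegaard torus,
   with coordinates (theta1, theta2), in which a box has side 2 pi / p. *)

Section SpecialKnot.
Context {R : realType}.
Implicit Types (f : R -> R) (g : R -> polar R).

Definition smooth f : Prop := forall n x, derivable (derive1n n f) x 1.

(* A smooth Legendrian curve for r1^2 dtheta1 + r2^2 dtheta2, avoiding the
   core curves r1 = 0 and r2 = 0. *)
Definition legendrian g : Prop :=
  [/\ [/\ smooth (r1 \o g), smooth (th1 \o g),
          smooth (r2 \o g) & smooth (th2 \o g)],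
      forall t, [/\ on_S3 (g t), 0 < r1 (g t) & 0 < r2 (g t)]
    & forall t, r1 (g t) ^+ 2 * derive1 (th1 \o g) t
                + r2 (g t) ^+ 2 * derive1 (th2 \o g) t = 0].

(* The box centers along the path: i boxes to the right of the center
   (pi/p, pi/p) of Box 0 for i <= h, then i - h boxes down from Box h. *)
Definition box_center (p h i : nat) : R * R :=
  (pi / p%:R + 2 * pi * (minn i h)%:R / p%:R,
   pi / p%:R - 2 * pi * (i - h)%:R / p%:R).

(* The i-th basepoint after sliding it by s i along its anti-diagonal. *)
Definition vertex (p h : nat) (s : nat -> R) (i : nat) : R * R :=
  ((box_center p h i).1 + s i, (box_center p h i).2 + s i).

Definition seg_slope (V : nat -> R * R) (i : nat) : R :=
  ((V i.+1).2 - (V i).2) / ((V i.+1).1 - (V i).1).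

Definition on_segment (A B P : R * R) : Prop :=
  exists2 l : R, 0 <= l <= 1 &
    P = ((1 - l) * A.1 + l * B.1, (1 - l) * A.2 + l * B.2).

Definition front g (t : R) : R * R := (th1 (g t), th2 (g t)).

Definition front_slope g (t : R) : R :=
  derive1 (th2 \o g) t / derive1 (th1 \o g) t.

Definition strictly_monotone_on (a b : R) f : Prop :=
  {in `[a, b] &, {homo f : x y / x < y}} \/
  {in `[a, b] &, {homo f : x y / x < y >-> y < x}}.

(* [g] has a special front projection with all perturbations of size < e.  The
   parameter is normalised so that [i + eta, i + 1 - eta] covers the straight
   part of the i-th segment and [i - eta, i + eta] the arc replacing a
   neighborhood of the i-th basepoint.  The basepoints 0 and h + v agree in
   L(p,q): they differ by the deck transformation F_{p,q}^(-v). *)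
Definition special_front (p h v : nat) (e : R) g : Prop :=
  let n := (h + v)%N in
  exists (s : nat -> R) (eta : R),
    let V := vertex p h s in
    [/\ s n = s 0%N /\ (forall i, (i <= n)%N -> `|s i| < e),
        (forall i, (i < n)%N -> seg_slope V i < 0) /\
        (forall i, (i.+1 < n)%N -> seg_slope V i.+1 < seg_slope V i),
        0 < eta < 2^-1,
        (forall t, th1 (g (t + n%:R)) = th1 (g t) + 2 * pi * h%:R / p%:R) /\
        (forall t, th2 (g (t + n%:R)) = th2 (g t) - 2 * pi * v%:R / p%:R)
      & [/\ forall t, 0 < derive1 (th1 \o g) t,
            forall (i : nat) (t : R), (i < n)%N -> t \in `[i%:R + eta, i.+1%:R - eta] ->
              on_segment (V i) (V i.+1) (front g t),
            forall (i : nat) (t : R), (i < n)%N -> t \in `[i%:R - eta, i%:R + eta] ->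
              `|(front g t).1 - (V i).1| < e /\ `|(front g t).2 - (V i).2| < e
          & forall i, (i < n)%N ->
              strictly_monotone_on (i%:R - eta) (i%:R + eta) (front_slope g)]].

(* K is the special knot K_0, with perturbations of size < e, in L(p,q). *)
Definition special_knot (p q h v : nat) (e : R)
    (K : set (set (R[i] * R[i]))) : Prop :=
  exists g, [/\ legendrian g, special_front p h v e g
              & K = [set lens_pt p q (g t) | t in [set: R]]].

End SpecialKnot.

(* Main.v *)
Require Import Defs.
From HB Require Import structures.
From mathcomp Require Import all_boot all_order all_algebra.
From mathcomp Require Import all_classical all_reals all_analysis.
From mathcomp Require Import complex.
From mathcomp Require Import ring lra zify.

(** Put [n = h + v]. As [gcd(q - 1, p) = 1], the azimuth of the Lagrangian projection
    is [phi = p (theta1 - theta2)]. Sliding a basepoint along the anti-diagonal of its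
    box does not change it, so the [i]-th vertex of the special front has azimuth
    exactly [2 pi i]; and as the front has negative slope, [phi] is strictly increasing
    along the knot and grows by [2 pi n] over one period. The projection is thus a
    closed braid with [n] strands around the axis of the sphere. Its height
    [r1^2 - r2^2] is a strictly decreasing function of the slope of the front
    ([legendrian_slope], [slope_height_lt]), so it is constant over the straight
    segments, with heights [H 0 < ... < H n.-1], and strictly monotone over the bends.
    Around longitude 0, the strand through vertex [i] climbs from [H i.-1] to [H i]
    for [0 < i < n], whereas the strand through vertex 0 comes down from [H n.-1] to
    [H 0] ([knot_braid]).

    Crossings. Each bend contains its vertex in its interior ([bend_avoids_vertex]), so
    at every longitude consecutive climbing strands are on different sides of the
    height at which they would meet, and are disjoint ([strand_lt]). The descending
    strand meets each of them, exactly once ([crossing_exists], [crossing_uniq]).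
    Hence there are [n - 1] multiple points, all double. The two points of the knot over
    such a point of the sphere are distinct in the lens space, being close to the centers
    of different boxes ([knot_point_neq]); this is what makes the perturbations small.

    Regions. Sorting the strands by height at each longitude turns the braid into [n]
    closed curves [level 1 <= ... <= level n], graphs over the circle of longitudes.
    A connected set that avoids the graph of such a curve stays on one side of it
    ([graph_separates]), so each of the [n + 1] regions bounded by consecutive levels is
    closed under taking connected sets in the complement. These regions are connected:
    the lowest and the highest one are caps around the poles, and the levels that bound
    any other one touch at a single longitude, that of a crossing, so that it is a band
    pinched at one point ([connected_pinched_band]). They are therefore the components of
    the complement ([card_braid_components]). *)

Set Implicit Arguments.
Unset Strict Implicit.
Unset Printing Implicit Defensive.

Import Order.TTheory GRing.Theory Num.Theory.
Import numFieldNormedType.Exports.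

Local Open Scope classical_set_scope.
Local Open Scope ring_scope.

(** * Angles and cylindrical coordinates on the sphere *)

Section Angles.
Context {R : realType}.
Implicit Types x y d : R.

Lemma periodic_int (T : Type) (f : R -> T) (P : R) :
  (forall x, f (x + P) = f x) -> forall (k : int) x, f (x + k%:~R * P) = f x.
Proof.
move=> fP; have fn (n : nat) x : f (x + n%:R * P) = f x.
  elim: n => [|n IH]; first by rewrite mul0r addr0.
  by rewrite -natr1 mulrDl mul1r addrA fP.
case=> n x; first exact: fn.
by rewrite NegzE rmorphN /= mulNr -[LHS](fn n.+1) subrK.
Qed.

Lemma cosDz2pi (k : int) x : cos (x + k%:~R * (2 * pi)) = cos x.
Proof. by apply: periodic_int; rewrite mulr_natl; exact: cosD2pi. Qed.

Lemma sinDz2pi (k : int) x : sin (x + k%:~R * (2 * pi)) = sin x.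
Proof. by apply: periodic_int; rewrite mulr_natl; exact: sinD2pi. Qed.

Lemma cos_eq1 d : cos d = 1 -> exists k : int, d = k%:~R * (2 * pi).
Proof.
move=> d1; have pi0 := @pi_gt0 R; have pi2 : 0 < 2 * pi :> R by lra.
pose k := Num.floor (d / (2 * pi)); exists k.
pose e := d - k%:~R * (2 * pi).
have dE : d = e + k%:~R * (2 * pi) by rewrite /e subrK.
have e0 : 0 <= e by rewrite subr_ge0 -ler_pdivlMr// floor_le_tmp.
have e2 : e / 2 < pi.
  have : d / (2 * pi) < (k + 1)%:~R by exact: floorD1_gt.
  by rewrite ltr_pdivrMr// intrD mulrDl mul1r /e; lra.
rewrite dE -[RHS]add0r; congr (_ + _).
have : cos e = 1 by rewrite -(cosDz2pi k) -dE.
have -> : e = (e / 2) *+ 2 by rewrite mulr2n; lra.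
rewrite cos_mulr2n cos2sin2 => s0.
have /eqP : sin (e / 2) ^+ 2 = 0 by move: s0; rewrite mulr2n; lra.
rewrite sqrf_eq0 => /eqP s1.
have [e00|] := leP (e / 2) 0; first by rewrite mulr2n; lra.
by move=> e00; have := @sin_gt0_pi R (e / 2); rewrite s1 ltxx e00 e2 => /(_ isT).
Qed.

Lemma cos_sin_eq x y : cos x = cos y -> sin x = sin y ->
  exists k : int, x = y + k%:~R * (2 * pi).
Proof.
move=> c s; have /cos_eq1[k kE] : cos (x - y) = 1.
  by rewrite cosB c s -!expr2 cos2Dsin2.
by exists k; rewrite -kE addrCA subrr addr0.
Qed.

Lemma polar_angle (a b : R) : a ^+ 2 + b ^+ 2 = 1 ->
  exists2 x, - pi <= x <= pi & a = cos x /\ b = sin x.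
Proof.
move=> ab1.
have a1 : -1 <= a <= 1 by nra.
have [y0 ypi] := (acos_ge0 a1, acos_lepi a1).
have ca : cos (acos a) = a by exact: acosK.
have sb : sin (acos a) ^+ 2 = b ^+ 2 by rewrite sin2cos2 ca -ab1; ring.
have s0 : 0 <= sin (acos a) by rewrite sin_ge0_pi// y0 ypi.
have pi0 := @pi_gt0 R.
have [b0|b0] := leP 0 b.
  exists (acos a); first lra.
  by rewrite ca; split => //; apply/eqP; rewrite eq_sym -(@eqrXn2 _ 2)//; apply/eqP.
exists (- acos a); first lra.
rewrite cosN sinN ca; split => //; apply/eqP; rewrite -eqr_oppLR eq_sym.
by rewrite -(@eqrXn2 _ 2)//; [rewrite sqrrN; apply/eqP|lra].
Qed.

End Angles.

Section Sphere.
Context {R : realType}.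
Implicit Types x z : R.

(** The point of longitude [x] and height [z]; it agrees with the Lagrangian
    projection as [2 r1 r2] is the square root of [1 - (r1^2 - r2^2)^2]. *)
Definition sphere_pt (x z : R) : R * R * R :=
  (Num.sqrt (1 - z ^+ 2) * cos x, Num.sqrt (1 - z ^+ 2) * sin x, z).

Lemma sphere_pt_S2 x z : -1 <= z <= 1 -> S2 (sphere_pt x z).
Proof.
move=> z1; rewrite /S2 /= !exprMn -mulrDr cos2Dsin2 mulr1 sqr_sqrtr; first ring.
nra.
Qed.

Lemma sphere_ptP (y : R * R * R) : S2 y ->
  exists x z, [/\ - pi <= x <= pi, -1 <= z <= 1 & y = sphere_pt x z].
Proof.
case: y => [[a b] z]; rewrite /S2 /= => yS.
have z1 : -1 <= z <= 1 by nra.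
have pi0 := @pi_gt0 R.
pose u := Num.sqrt (1 - z ^+ 2).
have u2 : u ^+ 2 = a ^+ 2 + b ^+ 2 by rewrite sqr_sqrtr; [lra|nra].
have [u0|u0] := eqVneq u 0.
  exists 0, z; split => //; first lra.
  have [-> ->] : a = 0 /\ b = 0 by rewrite u0 in u2; nra.
  by rewrite /sphere_pt -/u u0 !mul0r.
have [|x xpi [cx sx]] := @polar_angle R (a / u) (b / u).
  by rewrite !exprMn -mulrDl -u2 exprVn divff// expf_neq0.
exists x, z; split => //.
by rewrite /sphere_pt -/u -cx -sx !(mulrC u) !divfK.
Qed.

Lemma sphere_pt_eq x z x' z' : -1 < z < 1 -> sphere_pt x z = sphere_pt x' z' ->
  z = z' /\ exists k : int, x = x' + k%:~R * (2 * pi).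
Proof.
move=> z1 [+ + zE]; rewrite -{}zE {z'} => c s; split=> //.
have u0 : Num.sqrt (1 - z ^+ 2) != 0 by rewrite gt_eqF// sqrtr_gt0; nra.
by apply: cos_sin_eq; [exact: (mulfI u0)|exact: (mulfI u0)].
Qed.

Lemma sphere_ptD2pi x z (k : int) :
  sphere_pt (x + k%:~R * (2 * pi)) z = sphere_pt x z.
Proof. by rewrite /sphere_pt cosDz2pi sinDz2pi. Qed.

Lemma sphere_pt_piN z : sphere_pt (- pi) z = sphere_pt pi z.
Proof. by rewrite -(sphere_ptD2pi (- pi) z 1); congr sphere_pt; lra. Qed.

Lemma eq_mod2pi (x x' : R) (k : int) : - pi <= x <= pi -> - pi <= x' <= pi ->
  x = x' + k%:~R * (2 * pi) ->
  [\/ x = x', x = - pi /\ x' = pi | x = pi /\ x' = - pi].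
Proof.
move=> xpi x'pi xE; have pi0 := @pi_gt0 R.
have k1 : -1 <= k <= 1.
  by rewrite -!(ler_int R); apply/andP; split; nra.
have : (k = -1 \/ k = 0) \/ k = 1 by lia.
case=> [[]|] kE; rewrite kE ?mul0r in xE.
- by apply: Or32; lra.
- by apply: Or31; lra.
- by apply: Or33; lra.
Qed.

(** The longitude is only determined up to the ends of [-pi, pi], which a closed
    curve [f] does not tell apart. *)
Lemma sphere_pt_inj (f : R -> R) x z x' z' : f (- pi) = f pi ->
  - pi <= x <= pi -> - pi <= x' <= pi -> -1 < z < 1 ->
  sphere_pt x z = sphere_pt x' z' -> z = z' /\ f x = f x'.
Proof.
move=> fpi xpi x'pi z1 /(sphere_pt_eq z1)[-> [k /(eq_mod2pi xpi x'pi)]].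
by case=> [->|[-> ->]|[-> ->]].
Qed.

Lemma continuous_pair (T U V : topologicalType) (f : T -> U) (g : T -> V) t :
  {for t, continuous f} -> {for t, continuous g} ->
  {for t, continuous (fun u => (f u, g u))}.
Proof.
by move=> cf cg; apply: (@cvg_pair _ _ _ _ (nbhs (f t)) (nbhs (g t))).
Qed.

Lemma continuous_sphere_pt : continuous (fun u : R * R => sphere_pt u.1 u.2).
Proof.
move=> u; rewrite /sphere_pt.
have cr : {for u, continuous (fun u : R * R => Num.sqrt (1 - u.2 ^+ 2))}.
  apply: (@continuous_comp _ _ _ (fun u : R * R => 1 - u.2 ^+ 2)).
    apply: cvgB; first exact: cvg_cst.
    by apply: (@cvgM _ _ _ _ (fun u : R * R => u.2)); exact: cvg_snd.
  exact: sqrt_continuous.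
apply: continuous_pair; last exact: cvg_snd.
apply: continuous_pair; apply: cvgM => //.
  by apply: (continuous_comp _ (@continuous_cos R _)); exact: cvg_fst.
by apply: (continuous_comp _ (@continuous_sin R _)); exact: cvg_fst.
Qed.

End Sphere.

(** * Separation by a closed curve, and connected regions *)

Section SphereRegions.
Context {R : realType}.
Implicit Types (x z : R) (f g : R -> R).

Lemma closed_sphere_image (G : R * R -> R) : continuous G ->
  closed [set sphere_pt u.1 u.2 | u in
    [set u : R * R | [/\ - pi <= u.1 <= pi, -1 <= u.2 <= 1 & 0 <= G u]]].
Proof.
move=> cG; apply: compact_closed; first exact: norm_hausdorff.
apply: continuous_compact.
  by apply: continuous_subspaceT; exact: continuous_sphere_pt.
have -> : [set u : R * R | [/\ - pi <= u.1 <= pi, -1 <= u.2 <= 1 & 0 <= G u]]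
    = (`[- pi, pi] `*` `[-1, 1]) `&` G @^-1` [set` `[0, +oo[].
  apply/seteqP; split => u /=; rewrite !in_itv /= ?andbT.
    by case.
  by case=> -[].
apply: compact_closedI.
  by apply: compact_setX; exact: segment_compact.
by move/continuous_closedP : cG; apply; exact: interval_closed.
Qed.

(** The points of the sphere above, and those below, the closed curve that is
    the graph of [f] form two compact sets, which meet on this curve only; so a
    connected set that avoids the curve lies on one side of it. *)
Lemma graph_separates f (C : set (R * R * R)) : continuous f -> f (- pi) = f pi ->
  (forall x, - pi <= x <= pi -> -1 < f x < 1) ->
  connected C -> C `<=` @S2 R ->
  (forall x, - pi <= x <= pi -> ~ C (sphere_pt x (f x))) ->
  forall x z x' z', - pi <= x <= pi -> - pi <= x' <= pi ->
    -1 <= z <= 1 -> -1 <= z' <= 1 ->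
    C (sphere_pt x z) -> C (sphere_pt x' z') -> z < f x -> z' < f x'.
Proof.
move=> cf fpi f1 cC CS2 Cf x z x' z' xpi x'pi z1 z'1 Cxz Cxz' zf.
have cG1 : continuous (fun u : R * R => f u.1 - u.2).
  move=> u; apply: cvgB; last exact: cvg_snd.
  by apply: (continuous_comp _ (cf _)); exact: cvg_fst.
have cG2 : continuous (fun u : R * R => u.2 - f u.1).
  move=> u; apply: cvgB; first exact: cvg_snd.
  by apply: (continuous_comp _ (cf _)); exact: cvg_fst.
have cB := closed_sphere_image cG1; have cA := closed_sphere_image cG2.
set B := (X in closed X) in cB; set A := (X in closed X) in cA.
have AB y : C y -> A y -> B y -> False.
  move=> Cy [[u w] /= [upi w1 wf] wy] [[u' w'] /= [u'pi w'1 w'f] w'y].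
  have ww' : w' = w by move: w'y; rewrite -wy => -[].
  have f1u := f1 _ upi; have f1u' := f1 _ u'pi.
  have w1' : -1 < w < 1 by lra.
  have [] := sphere_pt_inj fpi upi u'pi w1' (etrans wy (esym w'y)).
  move=> _ fuu'; have wE : w = f u by lra.
  by apply: (Cf u) => //; rewrite -wE wy.
have ABS2 y : S2 y -> A y \/ B y.
  case/sphere_ptP=> u [w [upi w1 ->]].
  by have [fw|fw] := leP (f u) w; [left|right]; exists (u, w) => //=; split; lra.
have CB : C `&` B = C.
  apply: cC.
  - by exists (sphere_pt x z); split => //; exists (x, z) => //=; split; lra.
  - exists (~` A); first exact: closed_openC.
    apply/seteqP; split => y [Cy].
      by move=> By; split=> // Ay; exact: (AB y).
    by move=> nAy; split => //; case: (ABS2 _ (CS2 _ Cy)).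
  - by exists B.
rewrite ltNge; apply/negP => zf'.
apply: (AB _ Cxz'); first by exists (x', z') => //=; split; lra.
by move: Cxz'; rewrite -CB => -[].
Qed.

Lemma connected_image_itv (T : topologicalType) (c : R -> T) (i : interval R) :
  continuous c -> connected (c @` [set` i]).
Proof.
move=> cc; apply: connected_continuous_connected; last exact: continuous_subspaceT.
exact/connected_intervalP/interval_is_interval.
Qed.

Lemma connected_star (T : topologicalType) (E : set T) (y0 : T) :
  (forall y, E y -> exists C, [/\ connected C, C `<=` E, C y & C y0]) ->
  connected E.
Proof.
move=> Ey0.
have -> : E = \bigcup_(C in [set C | [/\ connected C, C `<=` E & C y0]]) C.
  apply/seteqP; split => y.
    by move=> /Ey0[C [cC CE Cy Cy0]]; exists C.
  by case=> C [_ + _]; exact.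
by apply: bigcup_connected; [exists y0 => C []|move=> C []].
Qed.

(** Clipping [z] to [-1, 1] lets a bound outside this interval stand for no bound,
    so that the polar caps are regions of this form. *)
Definition between f g : set (R * R * R) :=
  [set sphere_pt u.1 u.2 | u in
    [set u : R * R | [/\ - pi <= u.1 <= pi, -1 <= u.2 <= 1
                       & f u.1 < u.2 < g u.1]]].

Lemma continuous_meridian x : continuous (sphere_pt x).
Proof.
move=> z; apply: (@continuous_comp _ _ _ (fun z => (x, z))
  (fun u : R * R => sphere_pt u.1 u.2)); last exact: continuous_sphere_pt.
by apply: continuous_pair; [exact: cvg_cst|exact: cvg_id].
Qed.

(** Every point of a polar cap is joined to the pole by its meridian. *)
Lemma connected_south_cap f g : (forall x, f x < -1) ->
  (forall x, - pi <= x <= pi -> g x <= 1) -> connected (between f g).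
Proof.
move=> f1 g1; apply: (@connected_star _ _ (sphere_pt 0 (-1))) => y [[x z]] /=.
move=> [xpi z1 fzg] <-; have gx := g1 _ xpi.
exists (sphere_pt x @` `[-1, z]); split.
- by apply: connected_image_itv; exact: continuous_meridian.
- move=> _ [w wz <-]; rewrite /= in_itv /= in wz.
  by exists (x, w) => //=; split=> //; have := f1 x; lra.
- by exists z => //=; rewrite in_itv /=; lra.
- exists (-1); first by rewrite /= in_itv /=; lra.
  by rewrite /sphere_pt sqrrN expr1n subrr sqrtr0 !mul0r.
Qed.

Lemma connected_north_cap f g : (forall x, 1 < g x) ->
  (forall x, - pi <= x <= pi -> -1 <= f x) -> connected (between f g).
Proof.
move=> g1 f1; apply: (@connected_star _ _ (sphere_pt 0 1)) => y [[x z]] /=.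
move=> [xpi z1 fzg] <-; have fx := f1 _ xpi.
exists (sphere_pt x @` `[z, 1]); split.
- by apply: connected_image_itv; exact: continuous_meridian.
- move=> _ [w wz <-]; rewrite /= in_itv /= in wz.
  by exists (x, w) => //=; split=> //; have := g1 x; lra.
- by exists z => //=; rewrite in_itv /=; lra.
- exists 1; first by rewrite /= in_itv /=; lra.
  by rewrite /sphere_pt expr1n subrr sqrtr0 !mul0r.
Qed.

(** The band is cut open at its pinching point [c], so that it retracts, along
    the curves that divide its height in a fixed ratio, onto its meridian
    segment of longitude pi. *)
Lemma connected_pinched_band f g (c : R) : continuous f -> continuous g ->
  f (- pi) = f pi -> g (- pi) = g pi -> - pi < c < pi -> f c = g c ->
  (forall x, - pi <= x <= pi -> x != c -> f x < g x) ->
  (forall x, - pi <= x <= pi -> -1 <= f x /\ g x <= 1) ->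
  connected (between f g).
Proof.
move=> cf cg fpi gpi cpi fgc fg fg1.
have pi0 := @pi_gt0 R.
have pipi : - pi <= (pi : R) <= pi by lra.
have pic : (pi : R) != c by rewrite gt_eqF//; lra.
have := fg _ pipi pic; have [] := fg1 _ pipi => f1 g1 fgpi.
apply: (@connected_star _ _ (sphere_pt pi ((f pi + g pi) / 2))).
move=> y [[x z]] /= [xpi z1 fzg] <-.
have xc : x != c by apply: contraTneq fzg => ->; lra.
(* the curve [w] divides the height of the band in the ratio in which [z] does *)
pose s := (z - f x) / (g x - f x).
have fgx : 0 < g x - f x by lra.
have s01 : 0 < s < 1.
  by rewrite divr_gt0 ?ltr_pdivrMr ?mul1r//=; lra.
pose w t := f t + s * (g t - f t).
have wfg t : f t < g t -> f t < w t < g t by move=> fgt; rewrite /w; nra.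
have wx : w x = z by rewrite /w /s divfK ?gt_eqF//; lra.
have cw : continuous (fun t => sphere_pt t (w t)).
  move=> t; apply: (@continuous_comp _ _ _ (fun t => (t, w t))
    (fun u : R * R => sphere_pt u.1 u.2)); last exact: continuous_sphere_pt.
  apply: continuous_pair; first exact: cvg_id.
  apply: cvgD; first exact: cf.
  by apply: cvgM; [exact: cvg_cst|apply: cvgB; [exact: cg|exact: cf]].
pose M := sphere_pt pi @` `]f pi, g pi[.
have cM : connected M.
  by apply: connected_image_itv; exact: continuous_meridian.
have ME : M `<=` between f g.
  move=> _ [v vfg <-]; rewrite /= in_itv /= in vfg.
  by exists (pi, v) => //=; split => //; lra.
have My0 : M (sphere_pt pi ((f pi + g pi) / 2)).
  by exists ((f pi + g pi) / 2) => //=; rewrite in_itv /=; lra.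
have Mw : M (sphere_pt pi (w pi)).
  by exists (w pi) => //=; rewrite in_itv /= wfg.
(* an arc of longitudes that misses [c] and ends at the cut pi *)
have half (i : interval R) : [set` i] x -> [set` i] `<=` [set t | - pi <= t <= pi] ->
    ~ [set` i] c -> ([set` i] (- pi) \/ [set` i] pi) ->
    exists C, [/\ connected C, C `<=` between f g, C (sphere_pt x z)
                & C (sphere_pt pi ((f pi + g pi) / 2))].
  move=> ix ipi ic iend; exists (M `|` (fun t => sphere_pt t (w t)) @` [set` i]).
  split; [| |by right; exists x; rewrite ?wx|by left].
    apply: connectedU => //; last exact: connected_image_itv.
    exists (sphere_pt pi (w pi)); split => //.
    case: iend => iend; last by exists pi.
    by exists (- pi) => //; rewrite sphere_pt_piN /w fpi gpi.
  move=> u [/ME//|[t it <-]]; have tpi := ipi _ it.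
  have tc : t != c by apply/eqP => tc; apply: ic; rewrite -tc.
  have := wfg _ (fg _ tpi tc); have [ft gt] := fg1 _ tpi => wt.
  by exists (t, w t) => //=; split => //; lra.
have [xltc|cltx] := ltP x c.
  apply: (half `[- pi, x]); rewrite /= ?in_itv /=; [lra| |lra|left; lra].
  by move=> t /=; rewrite in_itv /=; lra.
have cltx' : c < x by rewrite lt_neqAle eq_sym xc.
apply: (half `[x, pi]); rewrite /= ?in_itv /=; [lra| |lra|right; lra].
by move=> t /=; rewrite in_itv /=; lra.
Qed.

End SphereRegions.

(** As no connected subset leaves a piece, the component of each point is the whole
    piece that contains it. *)
Lemma card_components (T : topologicalType) (A : set T) (E : nat -> set T) N :
  (forall k, (k < N)%N -> [/\ E k !=set0, connected (E k) & E k `<=` A]) ->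
  (forall y, A y -> exists2 k, (k < N)%N & E k y) ->
  (forall k C, (k < N)%N -> connected C -> C `<=` A -> C `&` E k !=set0 ->
     C `<=` E k) ->
  (forall j k, (j < N)%N -> (k < N)%N -> E j `&` E k !=set0 -> j = k) ->
  (components A #= `I_N)%card.
Proof.
move=> EA AE Emax Edisj.
have compE k y : (k < N)%N -> E k y -> connected_component A y = E k.
  move=> kN Eky; have [_ cE EkA] := EA _ kN; apply/seteqP; split.
    apply: Emax => //; [exact: component_connected|exact: connected_component_sub|].
    by exists y; split=> //; apply: connected_component_refl; exact: EkA.
  exact: connected_component_max.
have -> : components A = E @` `I_N.
  apply/seteqP; split => X.
    by case=> y /[dup] /AE[k kN Eky] Ay <-; exists k => //; rewrite (compE k).
  case=> k kN <-; have [[y Eky] _ EkA] := EA _ kN.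
  by exists y; [exact: EkA|exact: compE].
apply: inj_card_eq => j k; rewrite !inE /= => jN kN Ejk.
have [[y Ejy] _ _] := EA _ jN.
by apply: Edisj => //; exists y; split => //; rewrite -Ejk.
Qed.

(** * Closed braids with one descending strand *)

Section Ramps.
Context {R : realType}.
Implicit Types (A B : R) (f : R -> R).

(** A strand of the projection over one turn [-pi, pi]: the flat parts come from
    the straight segments of the front, the monotone one from a bend; longitude 0
    is that of a vertex, and the strict signs of [a] and [b] put it inside the
    bend. *)
Definition ramp A B f : Prop :=
  continuous f /\ exists a b : R,
    [/\ - pi < a < 0, 0 < b < pi, forall x, - pi <= x <= a -> f x = A,
        forall x, b <= x <= pi -> f x = B & strictly_monotone_on a b f].

Lemma rampN A B f : ramp A B f -> ramp (- A) (- B) (- f).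
Proof.
case=> cf [a [b [a0 b0 fA fB fm]]]; split; first by move=> x; apply: cvgN; exact: cf.
exists a, b; split=> // [x /fA|x /fB|]; rewrite ?fctE; try by move=> ->.
case: fm => fm; [right|left] => x y xab yab xy; rewrite /= ltrN2.
  exact: fm.
exact: fm.
Qed.

Section Increasing.
Context (A B : R) (f : R -> R) (ltAB : A < B) (framp : ramp A B f).

(** Precomposing with the clamping onto the bend extends its monotonicity to the
    whole turn. *)
Lemma ramp_clamp : exists a b : R, [/\ - pi < a < 0, 0 < b < pi, f a = A /\ f b = B,
  forall x, - pi <= x <= pi -> f x = f (Num.max a (Num.min x b))
  & forall x y, a <= x -> x < y -> y <= b -> f x < f y].
Proof.
case: framp => _ [a [b [a0 b0 fA fB fm]]]; exists a, b.
have fa : f a = A by apply: fA; lra.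
have fb : f b = B by apply: fB; lra.
split=> // [x xpi|x y ax xy yb].
  case: (leP x b) => [xb|/ltW bx]; last first.
    by rewrite fB ?max_r ?fb//; lra.
  by case: (leP a x) => // /ltW xa; rewrite fA ?fa//; lra.
case: fm => fm; first by apply: fm => //; rewrite in_itv /=; lra.
suff : f b < f a by rewrite fa fb => /lt_trans/(_ ltAB); rewrite ltxx.
by apply: fm; rewrite ?in_itv /=; lra.
Qed.

Lemma ramp_le x y : - pi <= x -> x <= y -> y <= pi -> f x <= f y.
Proof.
have [a [b [a0 b0 _ fE fm]]] := ramp_clamp => xpi xy ypi.
rewrite fE; last lra.
rewrite [f y]fE; last lra.
set u := Num.max a _; set w := Num.max a _.
have au : a <= u by rewrite le_max lexx.
have wb : w <= b by rewrite ge_max ge_min lexx orbT andbT; lra.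
have uw : u <= w.
  by rewrite ge_max !le_max lexx /= le_min !ge_min xy lexx orbT orbT.
by move: uw; rewrite le_eqVlt => /predU1P[->//|uw]; rewrite ltW// fm.
Qed.

Lemma ramp_ends : f (- pi) = A /\ f pi = B.
Proof.
case: framp => _ [a [b [a0 b0 fA fB _]]].
by split; [apply: fA|apply: fB]; lra.
Qed.

Lemma ramp_range x : - pi <= x <= pi -> A <= f x <= B.
Proof.
have [<- <-] := ramp_ends => /andP[x1 x2]; have pi0 := @pi_gt0 R.
by rewrite !ramp_le//; lra.
Qed.

Lemma ramp_lt_end x : - pi <= x <= 0 -> f x < B.
Proof.
have [a [b [a0 b0 [_ <-] fE fm]]] := ramp_clamp => xpi.
rewrite fE; last lra.
by rewrite min_l; [apply: fm; rewrite ?le_max ?gt_max ?lexx//; lra|lra].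
Qed.

Lemma ramp_gt_start x : 0 <= x <= pi -> A < f x.
Proof.
have [a [b [a0 b0 [<- _] fE fm]]] := ramp_clamp => xpi.
rewrite [f x]fE; last lra.
apply: fm; rewrite ?lexx//.
  by rewrite lt_max lt_min; apply/orP; right; apply/andP; split; lra.
by rewrite ge_max ge_min lexx orbT andbT; lra.
Qed.

Lemma ramp_flat x y : - pi <= x -> x < y -> y <= pi -> f x = f y ->
  f x = A \/ f x = B.
Proof.
have [a [b [a0 b0 [fa fb] fE fm]]] := ramp_clamp => xpi xy ypi.
have fx : f x = f (Num.max a (Num.min x b)) by apply: fE; lra.
have fy : f y = f (Num.max a (Num.min y b)) by apply: fE; lra.
have [xa|ax] := leP x a.
  by left; rewrite fx min_l ?max_l//; lra.
have [bx|xb] := leP b x.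
  by right; rewrite fx min_r ?max_r//; lra.
move=> fxy; suff : f x < f y by rewrite fxy ltxx.
rewrite fx fy; apply: fm.
- by rewrite le_max lexx.
- rewrite (min_l (ltW xb)) (max_r (ltW ax)) lt_max lt_min xy xb orbT.
  by [].
- by rewrite ge_max ge_min lexx orbT andbT; lra.
Qed.

End Increasing.
End Ramps.

Section Braid.
Context {R : realType}.

(** The strands over the circle of longitudes, [S i] being the one that arrives
    at height [H i]: each climbs one step, but [S 0] comes down all the way and
    closes the braid. *)
Definition braid (n : nat) (H : nat -> R) (S : nat -> R -> R) : Prop :=
  [/\ (1 < n)%N, forall i j, (i < j < n)%N -> H i < H j,
      forall i, (i < n)%N -> -1 < H i < 1, ramp (H n.-1) (H 0%N) (S 0%N)
    & forall i, (0 < i < n)%N -> ramp (H i.-1) (H i) (S i)].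

Context (n : nat) (H : nat -> R) (S : nat -> R -> R) (brS : braid n H S).
Implicit Types x y z : R.

Let n1 : (1 < n)%N. Proof. by case: brS. Qed.

Let ltH i j : (i < j < n)%N -> H i < H j.
Proof. by case: brS => _ lt_H _ _ _; exact: lt_H. Qed.

Lemma braid_leH i j : (i <= j < n)%N -> H i <= H j.
Proof.
case: (ltngtP i j) => // [ij jn|-> _]; last exact: lexx.
by rewrite ltW// ltH// ij.
Qed.

Let H1 i : (i < n)%N -> -1 < H i < 1.
Proof. by case: brS => _ _ H_1 _ _; exact: H_1. Qed.

Let rampS i : (0 < i < n)%N -> ramp (H i.-1) (H i) (S i).
Proof. by case: brS => _ _ _ _ ramp_S; exact: ramp_S. Qed.

Let rampD : ramp (- H n.-1) (- H 0%N) (- S 0%N).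
Proof. by case: brS => _ _ _ /rampN. Qed.

Let ltpred i : (0 < i < n)%N -> H i.-1 < H i.
Proof. by move=> i0; apply: ltH; lia. Qed.

Let ltD : - H n.-1 < - H 0%N. Proof. by rewrite ltrN2 ltH//; lia. Qed.

Lemma strand_continuous i : (i < n)%N -> continuous (S i).
Proof.
case: i => [_|i ilt]; first by case: brS => _ _ _ [].
by case: (@rampS i.+1).
Qed.

Lemma strand_range i x : (i < n)%N -> - pi <= x <= pi -> -1 < S i x < 1.
Proof.
move=> ilt xpi; case: i ilt => [_|i ilt].
  have := ramp_range ltD rampD xpi; rewrite fctE.
  have : -1 < H n.-1 < 1 by apply: H1; lia.
  have : -1 < H 0%N < 1 by apply: H1; lia.
  lra.
have := ramp_range (@ltpred i.+1 ilt) (rampS (i := i.+1) ilt) xpi => /=.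
have : -1 < H i < 1 by apply: H1; lia.
have := H1 ilt; lra.
Qed.

Lemma strand_ends i : (i < n)%N -> S i pi = H i /\
  S i (- pi) = H (if i == 0%N then n.-1 else i.-1).
Proof.
case: i => [_|i ilt] /=.
  by have [] := ramp_ends rampD; rewrite !fctE => /oppr_inj-> /oppr_inj->.
by have [] := ramp_ends (rampS (i := i.+1) ilt).
Qed.

(** At a step, the lower strand is strictly below it on the left of longitude
    0, and the upper one strictly above it on the right. *)
Lemma strand_lt i j x : (0 < i < j)%N -> (j < n)%N -> - pi <= x <= pi ->
  S i x < S j x.
Proof.
move=> ij jn xpi.
have i0 : (0 < i < n)%N by lia.
have j0 : (0 < j < n)%N by lia.
have Hij : H i <= H j.-1 by apply: braid_leH; lia.
have := ramp_range (ltpred i0) (rampS i0) xpi.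
have := ramp_range (ltpred j0) (rampS j0) xpi.
have [x0|x0] := leP x 0.
  have : S i x < H i by apply: (ramp_lt_end (ltpred i0) (rampS i0)); lra.
  lra.
have : H j.-1 < S j x by apply: (ramp_gt_start (ltpred j0) (rampS j0)); lra.
lra.
Qed.

Section Crossing.
Context (k : nat) (k0 : (0 < k < n)%N).

Let H0k : H 0%N <= H k.-1. Proof. by apply: braid_leH; lia. Qed.
Let Hkn : H k <= H n.-1. Proof. by apply: braid_leH; lia. Qed.

(** The strands meet inside the bend of the descending one, for the other strand
    is still below its top before longitude 0, and above its bottom after. *)
Lemma crossing_height x : - pi <= x <= pi -> S 0%N x = S k x ->
  H 0%N < S 0%N x < H n.-1.
Proof.
move=> xpi SE; have := H0k; have := Hkn.
have := ramp_range (ltpred k0) (rampS k0) xpi.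
have := ramp_range ltD rampD xpi; rewrite fctE.
have [x0|x0] := leP x 0.
  have : S k x < H k by apply: (ramp_lt_end (ltpred k0) (rampS k0)); lra.
  have : - S 0%N x < - H 0%N by apply: (ramp_lt_end ltD rampD); lra.
  lra.
have : H k.-1 < S k x by apply: (ramp_gt_start (ltpred k0) (rampS k0)); lra.
have : - H n.-1 < - S 0%N x by apply: (ramp_gt_start ltD rampD); lra.
lra.
Qed.

(** The difference of the climbing and the descending strand changes sign. *)
Lemma crossing_exists : exists2 c, - pi < c < pi & S 0%N c = S k c.
Proof.
have pi0 := @pi_gt0 R.
have [|kn kp] := @strand_ends k; first lia.
have [|nn np] := @strand_ends 0%N; first lia.
have {}kp : S k (- pi) = H k.-1 by rewrite kp; case: eqP => //; lia.
have Hk := ltpred k0; have := H0k; have := Hkn => HkN H0k'.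
have [| | |c] := @IVT R (fun x => S k x - S 0%N x) (- pi) pi 0.
- lra.
- apply: continuous_subspaceT => x; apply: cvgB; apply: strand_continuous; lia.
- rewrite kn kp nn np /= min_l ?max_r; lra.
rewrite in_itv /= => cpi /subr0_eq cE; exists c => //.
have [cN|cN] := eqVneq c (- pi).
  by have := crossing_height cpi (esym cE); rewrite cN np /=; lra.
have [cp|cp] := eqVneq c pi.
  by have := crossing_height cpi (esym cE); rewrite cp nn /=; lra.
by rewrite !lt_neqAle eq_sym cN cp.
Qed.

(** If two crossings were distinct, both strands would be flat in between, at
    the same height; but [S 0] is flat only at its two ends. *)
Lemma crossing_uniq x y : - pi <= x <= pi -> - pi <= y <= pi ->
  S 0%N x = S k x -> S 0%N y = S k y -> x = y.
Proof.
wlog xy : x y / x < y.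
  move=> IH xpi ypi ex ey; have [xy|yx|//] := ltgtP x y; first exact: IH.
  by apply/esym; apply: IH.
move=> xpi ypi ex ey.
have : S k x <= S k y by apply: (ramp_le (ltpred k0) (rampS k0)); lra.
have : - S 0%N x <= - S 0%N y by apply: (ramp_le ltD rampD); lra.
move=> h1 h2; have fxy : - S 0%N x = - S 0%N y by lra.
have := crossing_height xpi ex.
have [] := ramp_flat ltD rampD _ xy _ fxy; rewrite ?fctE; lra.
Qed.

End Crossing.

End Braid.

(** * The regions of the complement of a closed braid *)

Section Regions.
Context {R : realType}.

Lemma clampP (d w0 w1 : R) : w0 <= w1 ->
  [\/ d <= w0 /\ Num.max w0 (Num.min d w1) = w0,
      w0 <= d <= w1 /\ Num.max w0 (Num.min d w1) = d
    | w1 <= d /\ Num.max w0 (Num.min d w1) = w1].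
Proof.
move=> w01; have [d0|/ltW d0] := leP d w0.
  by apply: Or31; rewrite max_l// ge_min d0.
have [d1|/ltW d1] := leP d w1; first by apply: Or32; rewrite d0 max_r.
by apply: Or33; rewrite max_r.
Qed.

Context (n : nat) (H : nat -> R) (S : nat -> R -> R) (brS : braid n H S).
Implicit Types x z : R.

(** The climbing strands, completed by a floor and a ceiling off the sphere. *)
Definition wall (k : nat) (x : R) : R :=
  if k == 0%N then -2 else if (k < n)%N then S k x else 2.

(** Sorting the [n] strands at each longitude: as the climbing ones never meet,
    the [k]-th lowest strand is [S 0] clamped between two consecutive ones. *)
Definition level (k : nat) (x : R) : R :=
  Num.max (wall k.-1 x) (Num.min (S 0%N x) (wall k x)).

Definition region (k : nat) : set (R * R * R) := between (level k) (level k.+1).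

Definition braid_closure : set (R * R * R) :=
  [set y | exists i x,
    [/\ (i < n)%N, - pi <= x <= pi & y = sphere_pt x (S i x)]].

Let n1 : (1 < n)%N. Proof. by case: brS. Qed.

Lemma wall_strand k x : (0 < k < n)%N -> wall k x = S k x.
Proof. by rewrite /wall; case: k => //= k ->. Qed.

Lemma wall_lt j k x : (j < k)%N -> (j < n)%N -> - pi <= x <= pi ->
  wall j x < wall k x.
Proof.
move=> jk jn xpi; rewrite /wall.
have -> : (k == 0%N) = false by apply/eqP; lia.
rewrite jn; case: eqP => [_|j0]; case: (ltnP k n) => kn.
- by have := strand_range brS kn xpi; lra.
- lra.
- by rewrite (strand_lt brS)//; lia.
- by have := strand_range brS jn xpi; lra.
Qed.

Lemma wall_le j k x : (j <= k)%N -> - pi <= x <= pi -> wall j x <= wall k x.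
Proof.
move=> jk xpi; have [jn|nj] := ltnP j n.
  move: jk; rewrite leq_eqVlt => /predU1P[->|jk]; first exact: lexx.
  by rewrite ltW// wall_lt.
rewrite /wall !ltnNge nj (leq_trans nj jk) /=.
have -> : (k == 0%N) = false by apply/eqP; lia.
have -> : (j == 0%N) = false by apply/eqP; lia.
exact: lexx.
Qed.

Lemma wall_continuous k : continuous (wall k).
Proof.
rewrite /wall; case: eqP => _; first by move=> x; exact: cvg_cst.
case: ltnP => kn; first exact: (strand_continuous brS).
by move=> x; exact: cvg_cst.
Qed.

Lemma level_continuous k : continuous (level k).
Proof.
move=> x; apply: (@continuous_max R R (wall k.-1)); first exact: wall_continuous.
apply: (@continuous_min R R (S 0%N)); last exact: wall_continuous.
by apply: (strand_continuous brS); lia.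
Qed.

Lemma level0 x : level 0 x = -2.
Proof. by rewrite /level /wall /= max_l// ge_min lexx orbT. Qed.

Lemma levelSn x : - pi <= x <= pi -> level n.+1 x = 2.
Proof.
move=> xpi; rewrite /level /wall /= ltnn ltnNge leqnSn /=.
have -> : (n == 0%N) = false by apply/eqP; lia.
by rewrite max_l// ge_min lexx orbT.
Qed.

Lemma level_le_wall k x : - pi <= x <= pi -> level k x <= wall k x.
Proof.
move=> xpi; rewrite /level ge_max ge_min lexx orbT andbT.
by apply: wall_le => //; lia.
Qed.

Lemma wall_le_level k x : wall k x <= level k.+1 x.
Proof. by rewrite /level le_max lexx. Qed.

Lemma level_strand k x : (0 < k <= n)%N -> - pi <= x <= pi ->
  exists2 i, (i < n)%N & level k x = S i x.
Proof.
move=> kn xpi; have D1 : -1 < S 0%N x < 1 by apply: (strand_range brS); lia.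
have w01 : wall k.-1 x <= wall k x by apply: wall_le => //; lia.
have [[dw lE]|[_ lE]|[wd lE]] := clampP (S 0%N x) w01.
- have k2 : (0 < k.-1 < n)%N.
    by case: k kn lE w01 dw => [//|[|k]] /= kn _ _; rewrite /wall /=; [lra|lia].
  by exists k.-1; [lia|rewrite /level lE wall_strand].
- by exists 0%N; [lia|rewrite /level lE].
- have k2 : (0 < k < n)%N.
    case/andP: kn => k0; rewrite k0 leq_eqVlt => /predU1P[kE|//].
    by move: wd; rewrite /wall kE ltnn gtn_eqF ?(ltnW n1)//; lra.
  by exists k; [lia|rewrite /level lE wall_strand].
Qed.

Lemma level_range k x : (0 < k <= n)%N -> - pi <= x <= pi -> -1 < level k x < 1.
Proof. by move=> kn xpi; have [i ilt ->] := level_strand kn xpi; exact: (strand_range brS). Qed.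

Lemma level_le j k x : (j <= k)%N -> - pi <= x <= pi -> level j x <= level k x.
Proof.
move=> jk xpi; elim: k jk => [|k IH]; first by rewrite leqn0 => /eqP->.
rewrite leq_eqVlt => /predU1P[->//|/IH/le_trans]; apply.
exact: le_trans (level_le_wall k xpi) (wall_le_level k x).
Qed.

Lemma strand_level i x : (i < n)%N -> - pi <= x <= pi ->
  exists2 j, (0 < j <= n)%N & S i x = level j x.
Proof.
move=> ilt xpi; have [i0|i0] := posnP i.
  have D1 := strand_range brS ilt xpi; rewrite i0 in D1 *.
  have exj : exists j, S 0%N x <= wall j x.
    by exists n; rewrite /wall ltnn gtn_eqF ?(ltnW n1)//; lra.
  (* the first wall above [S 0] *)
  case: (ex_minnP exj) => j Dj jmin.
  have jn : (j <= n)%N.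
    by apply: jmin; rewrite /wall ltnn gtn_eqF ?(ltnW n1)//; lra.
  have j0 : (0 < j)%N by case: j Dj {jmin jn} => //; rewrite /wall /=; lra.
  have jD : wall j.-1 x <= S 0%N x.
    by rewrite leNgt; apply/negP => /ltW/jmin; lia.
  by exists j; [rewrite j0|rewrite /level (min_l Dj) max_r].
have w01 : wall i.-1 x <= wall i x by apply: wall_le => //; lia.
have w12 : wall i x <= wall i.+1 x by apply: wall_le.
have wi : wall i x = S i x by rewrite wall_strand// i0.
rewrite -wi; have [Di|/ltW iD] := leP (S 0%N x) (wall i x).
  exists i.+1 => //.
  by rewrite /level /= (min_l (le_trans Di w12)) max_l.
by exists i; [lia|rewrite /level (min_r iD) max_r].
Qed.

(** Unlike the strands, the levels close up after one turn: a strand ends at the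
    height where the next one starts. *)
Lemma level_ends k : (0 < k <= n)%N -> level k (- pi) = level k pi.
Proof.
move=> kn; rewrite /level.
have S0 := strand_ends brS (ltnW n1); case: S0 => [-> ->] /=.
have pi0 := @pi_gt0 R.
have w i : (0 < i < n)%N -> wall i (- pi) = H i.-1 /\ wall i pi = H i.
  move=> i0; rewrite !wall_strand//; have [|-> ->] := @strand_ends _ _ _ _ brS i; first lia.
  by split => //; case: eqP => //; lia.
have w0 y : wall 0 y = -2 by [].
have wn y : wall n y = 2 by rewrite /wall ltnn gtn_eqF ?(ltnW n1).
have H1 i : (i < n)%N -> -1 < H i < 1 by case: brS => _ _ H_1 _ _; exact: H_1.
have H0n : H 0%N <= H n.-1 by apply: (braid_leH brS); lia.
have H01 : -1 < H 0%N < 1 by apply: H1; lia.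
have Hn1 : -1 < H n.-1 < 1 by apply: H1; lia.
have [k1|k1] := leqP k 1.
  have -> : k = 1%N by lia.
  have [-> ->] := w 1%N n1; rewrite !w0 /=.
  have : H 0%N <= H 1%N by apply: (braid_leH brS).
  by move=> H01'; rewrite (min_r H0n) (min_l H01').
have [|-> ->] := w k.-1; first lia.
have Hk : H k.-2 <= H k.-1 by apply: (braid_leH brS); lia.
have H0k : H 0%N <= H k.-1 by apply: (braid_leH brS); lia.
have Hkn : H k.-1 <= H n.-1 by apply: (braid_leH brS); lia.
have [kn'|kn'] := ltnP k n.
  have [|-> ->] := w k; first lia.
  have H0k' : H 0%N <= H k by apply: (braid_leH brS); lia.
  by rewrite (min_r Hkn) (max_r Hk) (min_l H0k') (max_l H0k).
have -> : k = n by lia.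
rewrite !wn min_l ?min_l; [|lra..].
rewrite max_r; last by apply: (braid_leH brS); lia.
by rewrite max_l.
Qed.

Lemma level_lt k x : (0 < k < n)%N -> - pi <= x <= pi -> S 0%N x != S k x ->
  level k x < level k.+1 x.
Proof.
move=> kn xpi; rewrite -(wall_strand x kn) neq_lt => Dk.
have w01 : wall k.-1 x < wall k x by apply: wall_lt => //; lia.
have w12 : wall k x < wall k.+1 x by apply: wall_lt => //; lia.
have := clampP (S 0%N x) (ltW w01); have := clampP (S 0%N x) (ltW w12).
rewrite -/(level k x) -[X in Num.max X _]/(wall k.+1.-1 x) -/(level k.+1 x).
by case=> -[? ->]; case=> -[? ->]; case/orP: Dk => ?; lra.
Qed.

(** The two levels that bound an inner region agree where [S 0] crosses the
    strand between them, hence at exactly one longitude. *)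
Lemma region_connected k : (k <= n)%N -> connected (region k).
Proof.
(* the two polar caps, then the pinched bands *)
move=> kn; have [k0|k0] := posnP k.
  rewrite k0; apply: connected_south_cap => [x|x xpi]; first by rewrite level0; lra.
  by have := @level_range 1%N x; rewrite (ltnW n1) => /(_ isT xpi); lra.
move: kn; rewrite leq_eqVlt => /predU1P[kn|kn].
  rewrite /region kn.
  have -> : between (level n) (level n.+1) = between (level n) (fun=> 2).
    by apply/seteqP; split => y [u /= [upi u1]]; rewrite ?(levelSn upi) => ul <-;
      exists u => //=; split => //; rewrite ?(levelSn upi).
  apply: connected_north_cap => [x|x xpi]; first lra.
  by have := @level_range n x; rewrite (ltnW n1) leqnn => /(_ isT xpi); lra.
have kn' : (0 < k < n)%N by rewrite k0.
have [c cpi cE] := crossing_exists brS kn'.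
have cpi' : - pi <= c <= pi by lra.
apply: (@connected_pinched_band _ _ _ c) => //; try exact: level_continuous.
- by apply: level_ends; lia.
- by apply: level_ends; lia.
- rewrite /level /= cE -(wall_strand c kn').
  have w01 : wall k.-1 c <= wall k c by apply: wall_le => //; lia.
  have w12 : wall k c <= wall k.+1 c by apply: wall_le.
  by rewrite minxx (max_r w01) (min_l w12) maxxx.
- move=> x xpi xc; apply: level_lt => //; apply: contraNneq xc => xE.
  by rewrite (crossing_uniq brS kn' xpi cpi' xE cE).
- move=> x xpi.
  have : -1 < level k x < 1 by apply: level_range => //; lia.
  have : -1 < level k.+1 x < 1 by apply: level_range => //; lia.
  lra.
Qed.

Lemma region_nonempty k : (k <= n)%N -> region k !=set0.
Proof.
move=> kn; have pi0 := @pi_gt0 R; have pipi : - pi <= (pi : R) <= pi by lra.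
have n0 : (0 < n)%N by lia.
have inr (z : R) : -1 <= z <= 1 -> level k pi < z < level k.+1 pi -> region k !=set0.
  by move=> z1 zl; exists (sphere_pt pi z), (pi, z).
have [k0|k0] := posnP k.
  apply: (inr (-1)); first lra.
  rewrite k0 level0.
  by have := @level_range 1%N pi; rewrite n0 => /(_ isT pipi); lra.
move: kn; rewrite leq_eqVlt => /predU1P[kn|kn].
  apply: (inr 1); first lra.
  rewrite kn (levelSn pipi).
  by have := @level_range n pi; rewrite n0 leqnn => /(_ isT pipi); lra.
have kn' : (0 < k < n)%N by rewrite k0.
have H0k : H 0%N < H k by case: brS => _ lt_H _ _ _; exact: lt_H.
have l0 : -1 < level k pi < 1 by apply: level_range => //; lia.
have l1 : -1 < level k.+1 pi < 1 by apply: level_range => //; lia.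
have l01 : level k pi < level k.+1 pi.
  apply: level_lt => //; have [-> _] := strand_ends brS n0.
  by have [-> _] := strand_ends brS kn; rewrite lt_eqF.
by apply: (inr ((level k pi + level k.+1 pi) / 2)); lra.
Qed.

Lemma braid_closureP y : braid_closure y <->
  exists k x, [/\ (0 < k <= n)%N, - pi <= x <= pi & y = sphere_pt x (level k x)].
Proof.
split=> [[i [x [ilt xpi ->]]]|[k [x [kn xpi ->]]]].
  by have [k kn ->] := strand_level ilt xpi; exists k, x.
by have [i ilt ->] := level_strand kn xpi; exists i, x.
Qed.

Lemma region_sub k : region k `<=` @S2 R `\` braid_closure.
Proof.
move=> _ [[x z] /= [xpi z1 zk] <-]; split; first exact: sphere_pt_S2.
case/braid_closureP => j [x' [jn x'pi E]].
have zE : z = level j x' by have [_ _ ->] := E.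
have z1' : -1 < z < 1 by rewrite zE level_range.
have [_ lE] := sphere_pt_inj (level_ends jn) xpi x'pi z1' E.
have [jk|kj] := leqP j k; first by have := level_le jk xpi; lra.
by have := level_le kj xpi; lra.
Qed.

Lemma region_cover y : (@S2 R `\` braid_closure) y ->
  exists2 k, (k < n.+1)%N & region k y.
Proof.
case=> /sphere_ptP[x [z [xpi z1 ->]]] nclos.
have exj : exists j, z < level j x by exists n.+1; rewrite levelSn//; lra.
case: (ex_minnP exj) => -[|k] zk kmin; first by move: zk; rewrite level0; lra.
have kn : (k < n.+1)%N by apply: kmin; rewrite levelSn//; lra.
exists k => //; exists (x, z) => //=; split=> //; rewrite zk andbT.
have kz : level k x <= z by rewrite leNgt; apply/negP => /kmin; lia.
rewrite lt_neqAle kz andbT; apply/eqP => kzE.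
have [k0|k0] := posnP k; first by move: kzE; rewrite k0 level0; lra.
by apply: nclos; apply/braid_closureP; exists k, x; rewrite kzE k0.
Qed.

(** No level can be crossed within the complement of the braid. *)
Lemma region_maximal k C : (k < n.+1)%N -> connected C ->
  C `<=` @S2 R `\` braid_closure -> C `&` region k !=set0 -> C `<=` region k.
Proof.
move=> kn cC CS [y0 [Cy0 [[x z] /= [xpi z1 zk] y0E]]] y Cy.
have [Sy nclosy] := CS _ Cy.
have [x' [z' [x'pi z'1 yE]]] := sphere_ptP Sy.
rewrite -{}y0E {y0} in Cy0; rewrite {}yE {y Sy} in Cy nclosy *.
have C_S2 : C `<=` @S2 R by move=> u /CS[].
have sep j : (0 < j <= n)%N -> (z < level j x -> z' < level j x') /\
    (z' < level j x' -> z < level j x).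
  move=> jn; have sepj := graph_separates (@level_continuous j) (level_ends jn)
    (fun x => @level_range j x jn) cC C_S2.
  split; apply: sepj => // t tpi Ct; have [_] := CS _ Ct; apply.
    by apply/braid_closureP; exists j, t.
  by apply/braid_closureP; exists j, t.
exists (x', z') => //=; split=> //; apply/andP; split.
  have [->|k0] := posnP k; first by rewrite level0; lra.
  have kn' : (0 < k <= n)%N by rewrite k0.
  have kz : level k x' <= z'.
    by rewrite leNgt; apply/negP => /(sep _ kn').2; lra.
  rewrite lt_neqAle kz andbT; apply/eqP => kzE.
  by apply: nclosy; apply/braid_closureP; exists k, x'; rewrite kzE.
have [kn'|nk] := ltnP k n; first by apply: (sep k.+1 _).1 => //; lra.
have -> : k = n by apply/eqP; rewrite eqn_leq nk -ltnS kn.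
by rewrite levelSn//; lra.
Qed.

Lemma region_disjoint j k : (j < n.+1)%N -> (k < n.+1)%N ->
  region j `&` region k !=set0 -> j = k.
Proof.
wlog jk : j k / (j < k)%N.
  move=> IH jn kn jkE; have [jk|kj|//] := ltngtP j k; first exact: IH.
  by apply/esym; apply: IH => //; rewrite setIC.
move=> _ kn [y [[[x z] /= [xpi z1 zj] <-] [[x' z'] /= [x'pi z'1 z'k]]]] E.
have kn' : (0 < k <= n)%N by rewrite (leq_trans _ jk).
have zz' : z' = z by case: E.
have lk := level_range kn' xpi; have lk' := level_range kn' x'pi.
have ljk := level_le jk xpi.
have z'1' : -1 < z' < 1 by lra.
exfalso; have [_] := sphere_pt_inj (level_ends kn') x'pi xpi z'1' E; lra.
Qed.

(** This agrees with Euler's formula for a diagram with [n - 1] crossings and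
    [2 (n - 1)] edges. *)
Theorem card_braid_components :
  (components (@S2 R `\` braid_closure) #= `I_n.+1)%card.
Proof.
apply: (@card_components _ _ region).
- by move=> k kn; split;
    [exact: region_nonempty|exact: region_connected|exact: region_sub].
- exact: region_cover.
- exact: region_maximal.
- exact: region_disjoint.
Qed.

End Regions.

Lemma card_pair (T : Type) (a b : T) : a <> b -> ([set a; b] #= `I_2)%card.
Proof.
move=> ab; pose f i := if i is 0%N then a else b.
have -> : [set a; b] = f @` `I_2.
  apply/seteqP; split => y /=.
    by case=> ->; [exists 0%N|exists 1%N].
  by case=> -[|[|i]] //= _ <-; [left|right].
by apply: inj_card_eq => -[|[|i]] [|[|j]]; rewrite !inE //= => _ _ E; case: ab.
Qed.

(** * Knots that project to closed braids *)

Section BraidPresentation.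
Context {R : realType} (p q : nat).
Local Notation point := (set (R[i] * R[i])).

(** A knot of the lens space whose Lagrangian projection runs [n] times around
    the sphere, with monotone longitude, as a closed braid. *)
Definition braid_presentation (n : nat) (K : set point) : Prop :=
  exists (H : nat -> R) (Z : R -> R) (pt : R -> point),
    let S i psi := Z (2 * pi * i%:R + psi) in
    [/\ braid n H S, K = range pt,
        forall u, lag p q (pt u) = sphere_pt u (Z u),
        forall u, pt (u + 2 * pi * n%:R) = pt u
      & forall k c, (0 < k < n)%N -> - pi < c < pi -> S 0%N c = S k c ->
          pt (2 * pi * 0%:R + c) <> pt (2 * pi * k%:R + c)].

Context (n : nat) (H : nat -> R) (Z : R -> R) (pt : R -> point).
Let S i psi := Z (2 * pi * i%:R + psi).
Context (brS : braid n H S) (lag_pt : forall u, lag p q (pt u) = sphere_pt u (Z u)).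
Context (pt_n : forall u, pt (u + 2 * pi * n%:R) = pt u).
Context (pt_neq : forall k c, (0 < k < n)%N -> - pi < c < pi -> S 0%N c = S k c ->
  pt (2 * pi * 0%:R + c) <> pt (2 * pi * k%:R + c)).

Let n1 : (1 < n)%N. Proof. by case: brS. Qed.
Let n0 : (0 < n)%N. Proof. exact: ltnW. Qed.

Let ptS (i : nat) (psi : R) : point := pt (2 * pi * i%:R + psi).

Lemma lag_strand i psi : lag p q (ptS i psi) = sphere_pt psi (S i psi).
Proof.
rewrite lag_pt -/(S i psi) addrC -[2 * pi * _]mulrC.
exact: (@sphere_ptD2pi _ _ _ i%:Z).
Qed.

(** Reducing [u] modulo [2 pi] gives [psi], and the quotient modulo [n] tells which
    strand passes there. *)
Lemma strand_cover u : exists i psi, [/\ (i < n)%N, - pi <= psi < pi & pt u = ptS i psi].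
Proof.
have pi0 := @pi_gt0 R; have pi2 : 0 < 2 * pi :> R by lra.
pose j := Num.floor ((u + pi) / (2 * pi)).
have j_le : j%:~R * (2 * pi) <= u + pi by rewrite -ler_pdivlMr// floor_le_tmp.
have j_gt : u + pi < (j + 1)%:~R * (2 * pi) by rewrite -ltr_pdivrMr// floorD1_gt.
have nz : (n%:Z != 0) by rewrite eqz_nat -lt0n.
have jn : j = ((j %/ n%:Z)%Z * n%:Z + (j %% n%:Z)%Z) by exact: divz_eq.
have [i iE] : exists i : nat, (j %% n%:Z)%Z = i%:Z.
  by exists `|(j %% n%:Z)%Z|%N; rewrite gez0_abs// modz_ge0.
exists i, (u - j%:~R * (2 * pi)); split.
- by have := ltz_pmod j (n0 : 0 < n%:Z); rewrite iE.
- by rewrite intrD mulrDl mul1r in j_gt; lra.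
rewrite /ptS -[RHS](periodic_int pt_n (j %/ n%:Z)%Z); congr pt.
have -> : (j%:~R : R) = (j %/ n%:Z)%Z%:~R * n%:R + i%:R.
  by rewrite [in LHS]jn iE intrD intrM.
ring.
Qed.

Lemma lag_image_braid : lag p q @` range pt = braid_closure n S.
Proof.
apply/seteqP; split => [_ [_ [u _ <-] <-]|_ [i [psi [i_n psi_pi ->]]]].
  have [i [psi [i_n psi_pi ->]]] := strand_cover u.
  by exists i, psi; split => //; [lra|exact: lag_strand].
by exists (ptS i psi); [exists (2 * pi * i%:R + psi)|exact: lag_strand].
Qed.

Lemma lag_eq_strands i psi j psi' : (i < n)%N -> (j < n)%N ->
  - pi <= psi < pi -> - pi <= psi' < pi ->
  sphere_pt psi (S i psi) = sphere_pt psi' (S j psi') ->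
  psi = psi' /\ S i psi = S j psi.
Proof.
move=> i_n j_n psi_pi psi'_pi E.
have psi1 : - pi <= psi <= pi by lra.
have psi1' : - pi <= psi' <= pi by lra.
have [zE [k /(eq_mod2pi psi1 psi1')]] := sphere_pt_eq (strand_range brS i_n psi1) E.
by case=> [pE|[pE1 pE2]|[pE1 pE2]]; [rewrite zE pE|lra|lra].
Qed.

(** The climbing strands are disjoint, so [S 0] takes part in every crossing. *)
Lemma strand_eq_cases i j psi : (i < n)%N -> (j < n)%N -> - pi <= psi <= pi ->
  S i psi = S j psi -> [\/ i = j, i = 0%N /\ (0 < j)%N | j = 0%N /\ (0 < i)%N].
Proof.
move=> i_n j_n psi_pi E.
have [->|i0] := posnP i; first by case: (posnP j) => [->|j0]; [exact: Or31|exact: Or32].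
have [->|j0] := posnP j; first by apply: Or33.
have [ij|ji|->] := ltngtP i j; last exact: Or31.
  have ij' : (0 < i < j)%N by rewrite i0.
  by have := strand_lt brS ij' j_n psi_pi; rewrite E ltxx.
have ji' : (0 < j < i)%N by rewrite j0.
by have := strand_lt brS ji' i_n psi_pi; rewrite E ltxx.
Qed.

Let crossing k : exists c, (0 < k < n)%N -> - pi < c < pi /\ S 0%N c = S k c.
Proof.
case: (boolP (0 < k < n)%N) => [k_n|_]; last by exists 0.
by have [c c_pi cE] := crossing_exists brS k_n; exists c.
Qed.

(** Each of the [n - 1] climbing strands crosses [S 0] once, and no two of them
    do so at the same place. *)
Theorem braid_has_crossings : has_crossings p q (range pt) n.-1.
Proof.
have [c cP] := choice crossing.
pose y k := sphere_pt (c k) (S 0%N (c k)).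
have lag_crossing i psi j psi' : (i < n)%N -> (j < n)%N ->
    - pi <= psi < pi -> - pi <= psi' < pi -> ptS i psi <> ptS j psi' ->
    lag p q (ptS i psi) = lag p q (ptS j psi') ->
    exists2 k, (0 < k < n)%N & lag p q (ptS i psi) = y k.
  move=> i_n j_n psi_pi psi'_pi ne; rewrite !lag_strand.
  move=> /(lag_eq_strands i_n j_n psi_pi psi'_pi)[pE SE].
  have psi1 : - pi <= psi <= pi by lra.
  have at_c k : (0 < k < n)%N -> S 0%N psi = S k psi -> psi = c k.
    move=> k_n SkE; have [ck_pi ckE] := cP k k_n.
    by apply: (crossing_uniq brS k_n psi1 _ SkE ckE); lra.
  have [ij|[i0 j0]|[j0 i0]] := strand_eq_cases i_n j_n psi1 SE.
  - by case: ne; rewrite ij pE.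
  - subst i; have j_n' : (0 < j < n)%N by rewrite j0.
    by exists j => //; rewrite /y -(at_c j j_n' SE).
  - subst j; have i_n' : (0 < i < n)%N by rewrite i0.
    by exists i => //; rewrite /y -(at_c i i_n' (esym SE)) SE.
have fiberE k : (0 < k < n)%N ->
    range pt `&` lag p q @^-1` [set y k] = [set ptS 0%N (c k); ptS k (c k)].
  move=> k_n; have [ck_pi ckE] := cP k k_n; have k_lt : (k < n)%N by case/andP: k_n.
  have ck1 : - pi <= c k < pi by lra.
  have ck2 : - pi <= c k <= pi by lra.
  apply/seteqP; split => P /=; last first.
    case=> ->; split; try by exact: imageT.
      exact: lag_strand.
    by rewrite lag_strand -ckE.
  case=> -[u _ <-]; have [i [psi [i_n psi_pi ->]]] := strand_cover u.
  rewrite lag_strand /y => /(lag_eq_strands i_n n0 psi_pi ck1)[-> SE].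
  have [->|[-> _]|[_ i0]] := strand_eq_cases i_n n0 ck2 SE; [by left|by left|].
  rewrite ckE in SE.
  have [->|[i00 _]|[k00 _]] := strand_eq_cases i_n k_lt ck2 SE; first by right.
    by rewrite i00 in i0.
  by rewrite k00 in k_n.
have multE P Q : range pt P -> range pt Q -> P <> Q -> lag p q P = lag p q Q ->
    exists2 k, (0 < k < n)%N & lag p q P = y k.
  move=> [u _ <-] [w _ <-]; have [i [psi [i_n psi_pi ->]]] := strand_cover u.
  have [j [psi' [j_n psi'_pi ->]]] := strand_cover w; exact: lag_crossing.
split => [y0 [P [Q [[KP lP] [KQ lQ] PQ]]]|].
  have [k k_n yE] := multE _ _ KP KQ PQ (etrans lP (esym lQ)).
  have -> : y0 = y k by rewrite -yE.
  rewrite fiberE//; apply: card_pair; have [ck_pi ckE] := cP k k_n.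
  exact: pt_neq.
set M := [set _ | _].
have -> : M = (fun k => y k.+1) @` `I_n.-1.
  apply/seteqP; split => y0.
    case=> P [Q [[KP lP] [KQ lQ] PQ]].
    have [[//|k] k_n yE] := multE _ _ KP KQ PQ (etrans lP (esym lQ)).
    by exists k => /=; [rewrite -ltnS prednK|rewrite -yE].
  case=> k /= k_n <-; have k_n' : (0 < k.+1 < n)%N by rewrite -ltn_predRL.
  have [ck_pi ckE] := cP _ k_n'.
  exists (ptS 0%N (c k.+1)), (ptS k.+1 (c k.+1)).
  by rewrite fiberE//; split; [left|right|exact: pt_neq].
apply: inj_card_eq => j k; rewrite !inE /= => j_n k_n yE.
have j_n' : (0 < j.+1 < n)%N by rewrite -ltn_predRL.
have k_n' : (0 < k.+1 < n)%N by rewrite -ltn_predRL.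
have [cj cjE] := cP _ j_n'; have [ck ckE] := cP _ k_n'.
have cj1 : - pi <= c j.+1 < pi by lra.
have ck1 : - pi <= c k.+1 < pi by lra.
have [cE _] := lag_eq_strands n0 n0 cj1 ck1 yE.
have cj2 : - pi <= c j.+1 <= pi by lra.
have SE : S j.+1 (c j.+1) = S k.+1 (c j.+1) by rewrite -cjE cE.
have j_lt : (j.+1 < n)%N by case/andP: j_n'.
have k_lt : (k.+1 < n)%N by case/andP: k_n'.
by have [[->]|[]|[]] := strand_eq_cases j_lt k_lt cj2 SE.
Qed.

End BraidPresentation.

Theorem braid_presentation_count (R : realType) (p q n : nat)
    (K : set (set (R[i] * R[i]))) : braid_presentation p q n K ->
  has_crossings p q K n.-1 /\
  (components (@S2 R `\` lag p q @` K) #= `I_n.+1)%card.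
Proof.
case=> H [Z [pt [brS -> lag_pt pt_n pt_neq]]]; split.
  exact: (braid_has_crossings brS lag_pt pt_n pt_neq).
by rewrite (lag_image_braid brS lag_pt pt_n); exact: card_braid_components brS.
Qed.

(** * Real analysis *)

Section Calculus.
Context {R : realType}.
Implicit Types (f x y : R -> R) (a b t : R).

Lemma derivable_continuous f : (forall t, derivable f t 1) -> continuous f.
Proof. by move=> df t; apply/differentiable_continuous/derivable1_diffP. Qed.

Lemma mean_value f a b : (forall t, derivable f t 1) -> a < b ->
  exists2 c, a < c < b & f b - f a = derive1 f c * (b - a).
Proof.
move=> df ab; have [t _|c] := @MVT R f (derive1 f) a b ab _
  (continuous_subspaceT (derivable_continuous df)).
  by rewrite derive1E; exact: derivableP.
by rewrite in_itv /= => ? ?; exists c.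
Qed.

Lemma pos_derive_lt f a b : (forall t, derivable f t 1) ->
  (forall t, 0 < derive1 f t) -> a < b -> f a < f b.
Proof.
move=> df f0 ab; have [c _ E] := mean_value df ab.
by rewrite -subr_gt0 E mulr_gt0// subr_gt0.
Qed.

Lemma is_derive_comb a b x y t : derivable x t 1 -> derivable y t 1 ->
  is_derive t 1 (fun t => a * x t + b * y t) (a * derive1 x t + b * derive1 y t).
Proof.
move=> /derivableP dx /derivableP dy; rewrite !derive1E.
exact: is_deriveD.
Qed.

Lemma derivable_comb a b x y t : derivable x t 1 -> derivable y t 1 ->
  derivable (fun t => a * x t + b * y t) t 1.
Proof. by move=> dx dy; case: (is_derive_comb a b dx dy). Qed.

Lemma derive1_comb a b x y t : derivable x t 1 -> derivable y t 1 ->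
  derive1 (fun t => a * x t + b * y t) t = a * derive1 x t + b * derive1 y t.
Proof.
by move=> dx dy; rewrite [LHS]derive1E; case: (is_derive_comb a b dx dy).
Qed.

Lemma derive1_translate f T c : (forall t, f (t + T) = f t + c) ->
  forall t, derive1 f (t + T) = derive1 f t.
Proof.
move=> fT t; rewrite /derive1.
suff -> : (fun k => k^-1 *: (f (k + (t + T)) - f (t + T))) =
          (fun k => k^-1 *: (f (k + t) - f t)) by [].
by apply/funext => k; rewrite addrA !fT; congr (_ *: _); ring.
Qed.

Lemma continuous_eq0_segment f a b : continuous f -> a < b ->
  (forall t, a < t < b -> f t = 0) -> forall t, a <= t <= b -> f t = 0.
Proof.
move=> cf ab f0 t /andP[at_ tb].
have lim0 (F : set_system R) (FF : ProperFilter F) :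
    f @ F --> f t -> (\forall u \near F, a < u < b) -> f t = 0.
  move=> Ff Fab; apply: (cvg_unique (@Rhausdorff R) Ff).
  by apply: cvg_near_cst; apply: filterS Fab => u; exact: f0.
have [{}at_|ta] := ltP a t; last first.
  have {ta}tE : t = a by apply/eqP; rewrite eq_le ta at_.
  apply: (lim0 t^'+); first exact/cvg_at_right_filter/cf.
  near=> u; apply/andP; split; near: u; rewrite tE.
    exact: nbhs_right_gt.
  exact: nbhs_right_lt.
have [{}tb|bt] := ltP t b; first by rewrite f0// at_.
have {bt}tE : t = b by apply/eqP; rewrite eq_le tb bt.
apply: (lim0 t^'-); first exact/cvg_at_left_filter/cf.
near=> u; apply/andP; split; near: u; rewrite tE.
  exact: nbhs_left_gt.
exact: nbhs_left_lt.
Unshelve. all: by end_near. Qed.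

(** The derivatives agree inside the segment, hence by continuity at its ends,
    where the curve may leave the line. *)
Lemma affine_derive1 x y m c a b :
  (forall t, derivable x t 1) -> (forall t, derivable y t 1) ->
  continuous (derive1 x) -> continuous (derive1 y) -> a < b ->
  (forall t, a <= t <= b -> y t = m * x t + c) ->
  forall t, a <= t <= b -> derive1 y t = m * derive1 x t.
Proof.
move=> dx dy cx cy ab yE t tab; apply: subr0_eq.
apply: (@continuous_eq0_segment (fun t => derive1 y t - m * derive1 x t) a b) => //.
  by move=> u; apply: cvgB; [exact: cy|apply: cvgM; [exact: cvg_cst|exact: cx]].
move=> u uab.
transitivity (derive1 (fun t => 1 * y t + - m * x t) u).
  by rewrite derive1_comb// mul1r mulNr.
rewrite derive1E (@near_eq_derive _ _ _ _ (cst c)); first by rewrite derive_cst.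
have : \forall w \near u, w \in `]a, b[ by apply: near_in_itvoo; rewrite in_itv.
apply: filterS => w; rewrite in_itv /= => wab.
by rewrite yE; [rewrite /=; ring|lra].
Qed.

End Calculus.

Section Inverse.
Context {R : realType}.
Context (f : R -> R) (N T : R) (N0 : 0 < N) (T0 : 0 < T) (cf : continuous f).
Context (f_lt : forall a b, a < b -> f a < f b).
Context (fNT : forall t, f (t + N) = f t + T).

Lemma translate_nat (k : nat) t : f (t + k%:R * N) = f t + k%:R * T.
Proof.
elim: k => [|k IH]; first by rewrite !mul0r !addr0.
by rewrite -addn1 !natrD !mulrDl !mul1r !addrA fNT IH.
Qed.

(** The values at the multiples of the period [N] are unbounded on both sides,
    so that [f] is onto. *)
Lemma increasing_translate_inverse :
  exists2 tau : R -> R, continuous tau & forall u, f (tau u) = u.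
Proof.
have surj u : exists t, f t = u.
  pose k := Num.bound ((u - f 0) / T).
  have : `|(u - f 0) / T| < k%:R by exact: unstable.ltr_norm_bound.
  rewrite ltr_norml ltr_pdivrMr// ltr_pdivlMr// => uk.
  have kN : 0 <= k%:R * N by rewrite mulr_ge0// ltW.
  have fk : f (k%:R * N) = f 0 + k%:R * T by rewrite -[k%:R * N]add0r translate_nat.
  have fNk : f (- (k%:R * N)) = f 0 - k%:R * T.
    by have := translate_nat k (- (k%:R * N)); rewrite addNr => ->; ring.
  have [| | |c _ cE] := @IVT R f (- (k%:R * N)) (k%:R * N) u; last by exists c.
  - lra.
  - exact: continuous_subspaceT.
  - by rewrite fk fNk min_l ?max_r; lra.
have [tau tauK] := choice surj; exists tau => // u.
apply/cvgrPdist_lt => d d0; near=> w.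
have le_f s t : f s < f t -> s < t.
  by move=> fst; rewrite ltNge le_eqVlt negb_or -leNgt; apply/andP; split;
     [apply/eqP => E; rewrite E ltxx in fst|
      rewrite leNgt; apply/negP => /f_lt; rewrite ltNge (ltW fst)].
have lo : f (tau u - d) < w.
  near: w; apply: lt_nbhsr; rewrite -[X in _ < X]tauK; apply: f_lt; lra.
have hi : w < f (tau u + d).
  near: w; apply: lt_nbhsl; rewrite -[X in X < _]tauK; apply: f_lt; lra.
rewrite -[w]tauK in lo hi; have := le_f _ _ lo; have := le_f _ _ hi.
by rewrite ltr_norml; lra.
Unshelve. all: by end_near. Qed.

End Inverse.

(** * Arithmetic of grid number one diagrams *)

Lemma mod_unique_le (p q h a b : nat) : coprime q p -> (a <= b < p)%N ->
  (p %| h + a * q)%N -> (p %| h + b * q)%N -> a = b.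
Proof.
move=> cop /andP[ab bp] da db; apply/eqP; rewrite eqn_leq ab leqNgt /=.
apply/negP => lt_ab; have : (p %| (b - a) * q)%N.
  by rewrite mulnBl -(subnDl h) dvdn_sub.
rewrite Gauss_dvdl 1?coprime_sym// => /dvdn_leq.
by rewrite subn_gt0 [(p <= _)%N]leqNgt (leq_ltn_trans (leq_subr a b) bp) => /(_ lt_ab).
Qed.

(** The box reached after [i] steps of the path is not Box 0: its position, [minn i h]
    boxes to the right and [i - h] down, is [minn i h + (i - h) q] boxes along the
    row, since going down one box amounts to going right [q] boxes. *)
Lemma path_center_neq0 (p q h v i : nat) : coprime q p -> (h + v < p)%N ->
  (p %| h + v * q)%N -> (0 < i < h + v)%N -> ~~ (p %| minn i h + (i - h) * q)%N.
Proof.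
move=> cop hvp pv i_n; apply/negP; have [ih|hi] := leqP i h.
  have -> : (i - h = 0)%N by apply/eqP; rewrite subn_eq0.
  rewrite mul0n addn0 => /dvdn_leq; clear -i_n hvp; lia.
move=> pi_.
have : (i - h)%N = v by apply: (mod_unique_le cop (h := h)) => //; clear -hi i_n hvp; lia.
by clear -hi i_n; lia.
Qed.

Lemma grid_one_bounds (p q h v : nat) : coprime q p -> grid_one p q h v ->
  [/\ (0 < h)%N, (0 < v)%N, (h + v < p)%N & (p %| h + v * q)%N].
Proof.
move=> cop [s [w [s1 [w1 dw] hE [v1 dv]]]].
have vp : (v < p)%N by clear -v1; lia.
have veq w' : (w' < p)%N -> (p %| h + w' * q)%N -> v = w'.
  move=> w'p dw'; have [vw|/ltnW vw] := leqP v w'.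
    by apply: (mod_unique_le cop (h := h)) => //; rewrite vw.
  by apply/esym; apply: (mod_unique_le cop (h := h)) => //; rewrite vw.
have v0 : (0 < v)%N by case/andP: v1.
case: hE => -[sw hE].
  have wp : (w < p)%N by clear -sw; lia.
  have wv : v = w by apply: veq => //; rewrite hE.
  by split=> //; clear dv veq dw; lia.
have sp : (s <= p)%N by clear -s1; lia.
have wp : (w <= p)%N by clear -w1; lia.
have dpw : (p %| h + (p - w) * q)%N.
  rewrite -(dvdn_addl _ dw); suff -> : (h + (p - w) * q + (s + w * q) = p * q.+1)%N.
    exact: dvdn_mulr.
  by rewrite addnACA hE subnK// -mulnDl subnK// mulnS.
have vE : v = (p - w)%N by apply: veq => //; clear -w1; lia.
by split=> //; clear dv veq dw dpw; lia.
Qed.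

(** * Slope and height of a Legendrian curve *)

Section SlopeHeight.
Context {R : realType}.

(** The height [r1^2 - r2^2] at which a Legendrian front has slope [m]. *)
Definition slope_height (m : R) : R := (m + 1) / (m - 1).

Lemma slope_height_lt m m' : m' < 0 -> m < m' -> slope_height m' < slope_height m.
Proof.
move=> m'0 mm'; rewrite /slope_height -subr_gt0.
have -> : (m + 1) / (m - 1) - (m' + 1) / (m' - 1) =
    2 * (m' - m) / ((m - 1) * (m' - 1)).
  by field; rewrite !lt_eqF//; lra.
by rewrite divr_gt0//; [lra|rewrite -mulrNN mulr_gt0//; lra].
Qed.

Lemma slope_height_range m : m < 0 -> -1 < slope_height m < 1.
Proof.
move=> m0; have d0 : m - 1 < 0 by lra.
by rewrite /slope_height ltr_ndivlMr// ltr_ndivrMr//; lra.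
Qed.

Lemma legendrian_slope (a b dx dy : R) : 0 < a -> 0 < b ->
  a ^+ 2 + b ^+ 2 = 1 -> a ^+ 2 * dx + b ^+ 2 * dy = 0 -> 0 < dx ->
  dy / dx < 0 /\ a ^+ 2 - b ^+ 2 = slope_height (dy / dx).
Proof.
move=> a0 b0 ab1 abd dx0.
have a2 : 0 < a ^+ 2 by rewrite exprn_gt0.
have b2 : 0 < b ^+ 2 by rewrite exprn_gt0.
have mE : dy / dx = - a ^+ 2 / b ^+ 2.
  apply/eqP; rewrite eqr_div ?lt0r_neq0//; apply/eqP; lra.
rewrite mE mulNr oppr_lt0 divr_gt0//; split=> //.
rewrite /slope_height; set k := a ^+ 2 / b ^+ 2.
have kB : k * b ^+ 2 = a ^+ 2 by rewrite divfK// lt0r_neq0.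
have k0 : 0 < k by rewrite divr_gt0.
apply/esym; apply: (canLR (mulfK _)); first by rewrite lt_eqF//; lra.
transitivity ((1 - k) * (k * b ^+ 2 + b ^+ 2)); first by rewrite kB ab1; ring.
by rewrite -kB; ring.
Qed.

End SlopeHeight.

Section PolarCoordinates.
Context {R : realType}.

Lemma toC2_mod2pi (a b c d c' d' : R) (k l : int) :
  c' = c + k%:~R * (2 * pi) -> d' = d + l%:~R * (2 * pi) ->
  toC2 (Polar a c' b d') = toC2 (Polar a c b d).
Proof. by move=> -> ->; rewrite /toC2 /= !cosDz2pi !sinDz2pi. Qed.

Lemma polar_angle_uniq (r r' A B : R) : 0 < r -> 0 < r' ->
  r * cos A = r' * cos B -> r * sin A = r' * sin B ->
  exists k : int, B = A + k%:~R * (2 * pi).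
Proof.
move=> r0 r'0 ec es.
have rr' : r = r'.
  apply/eqP; rewrite -(@eqrXn2 _ 2) ?ltW//; apply/eqP.
  rewrite -[LHS]mulr1 -[RHS]mulr1 -{1}(cos2Dsin2 A) -(cos2Dsin2 B) !mulrDr.
  by rewrite -!exprMn ec es.
have rn0 : r != 0 by rewrite gt_eqF.
by apply: cos_sin_eq; apply: (mulfI rn0); rewrite ?ec ?es rr'.
Qed.

Lemma int_small (m : int) : `|2 * pi * m%:~R : R| < 2 -> m = 0.
Proof.
have pi2 := @pi_ge2 R; rewrite ltr_norml => m2.
have : -1 < m < 1 by rewrite -!(ltr_int R); apply/andP; split; nra.
by lia.
Qed.

End PolarCoordinates.

(** * The special knot as a closed braid *)

Section SpecialKnot.
Context {R : realType} (p h v : nat) (e eta : R) (s : nat -> R) (g : R -> polar R).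

Implicit Types t a b : R.

Let n := (h + v)%N.
Let V := vertex p h s.
Let x := th1 \o g.
Let y := th2 \o g.
Let slope := front_slope g.

(* the bound [e = 1 / (16 p)] on the perturbations is far smaller than a box *)
Context (p0 : (0 < p)%N) (h0 : (0 < h)%N) (v0 : (0 < v)%N).
Context (pe : p%:R * e = 16^-1) (leg : legendrian g) (eta01 : 0 < eta < 2^-1).
Context (s_n : s n = s 0%N) (s_lt : forall i, (i <= n)%N -> `|s i| < e).
Context (seg_neg : forall i, (i < n)%N -> seg_slope V i < 0).
Context (seg_decr : forall i, (i.+1 < n)%N -> seg_slope V i.+1 < seg_slope V i).
Context (x_n : forall t, th1 (g (t + n%:R)) = th1 (g t) + 2 * pi * h%:R / p%:R).
Context (y_n : forall t, th2 (g (t + n%:R)) = th2 (g t) - 2 * pi * v%:R / p%:R).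
Context (x_pos : forall t, 0 < derive1 x t).
Context (g_seg : forall (i : nat) (t : R), (i < n)%N ->
  t \in `[i%:R + eta, i.+1%:R - eta] -> on_segment (V i) (V i.+1) (front g t)).
Context (g_arc : forall (i : nat) (t : R), (i < n)%N ->
  t \in `[i%:R - eta, i%:R + eta] ->
  `|(front g t).1 - (V i).1| < e /\ `|(front g t).2 - (V i).2| < e).
Context (slope_arc : forall i, (i < n)%N ->
  strictly_monotone_on (i%:R - eta) (i%:R + eta) slope).

Let P : R := p%:R.
Let P0 : 0 < P. Proof. by rewrite ltr0n. Qed.
Let Pn0 : P != 0. Proof. by rewrite gt_eqF. Qed.
Let n1 : (1 < n)%N. Proof. by rewrite /n; move: h0 v0; clear; lia. Qed.
Let n0 : (0 < n)%N. Proof. exact: ltnW. Qed.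

Let dx t : derivable x t 1.
Proof. by case: leg => -[_ sx _ _] _ _; exact: (sx 0%N). Qed.
Let dy t : derivable y t 1.
Proof. by case: leg => -[_ _ _ sy] _ _; exact: (sy 0%N). Qed.
Let cdx : continuous (derive1 x).
Proof. by case: leg => -[_ sx _ _] _ _; exact: derivable_continuous (sx 1%N). Qed.
Let cdy : continuous (derive1 y).
Proof. by case: leg => -[_ _ _ sy] _ _; exact: derivable_continuous (sy 1%N). Qed.

Definition knot_height (t : R) : R := r1 (g t) ^+ 2 - r2 (g t) ^+ 2.

(** The azimuth of the Lagrangian projection, as [gcd(q - 1, p) = 1]. *)
Definition knot_phase (t : R) : R := P * x t + - P * y t.

Let z := knot_height.
Let phi := knot_phase.

Lemma height_slope t : slope t < 0 /\ z t = slope_height (slope t).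
Proof.
case: leg => _ /(_ t)[[_ _ rr1] r1_0 r2_0] /(_ t) rd.
exact: (legendrian_slope r1_0 r2_0 rr1 rd (x_pos t)).
Qed.

Lemma height_continuous : continuous z.
Proof.
case: leg => -[sr1 _ sr2 _] _ _ t.
have c1 : {for t, continuous (r1 \o g)} by apply: derivable_continuous (sr1 0%N) _.
have c2 : {for t, continuous (r2 \o g)} by apply: derivable_continuous (sr2 0%N) _.
by apply: cvgB; rewrite !expr2; apply: cvgM.
Qed.

Let dphi t : derivable phi t 1.
Proof. exact: derivable_comb. Qed.

Lemma phase_continuous : continuous phi.
Proof. exact: derivable_continuous dphi. Qed.

(** The front goes to the right and down. *)
Lemma phase_lt a b : a < b -> phi a < phi b.
Proof.
apply: pos_derive_lt => // t; rewrite /phi /knot_phase derive1_comb//.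
have [m0 _] := height_slope t; have x0 := x_pos t.
have : derive1 y t = slope t * derive1 x t by rewrite divfK ?gt_eqF.
move=> ->; have -> : P * derive1 x t + - P * (slope t * derive1 x t) =
  P * derive1 x t * (1 - slope t) by ring.
by rewrite !mulr_gt0//; lra.
Qed.

Lemma phase_n t : phi (t + n%:R) = phi t + 2 * pi * n%:R.
Proof. by rewrite /phi /knot_phase /x /y /= x_n y_n natrD; field. Qed.

Lemma slope_n t : slope (t + n%:R) = slope t.
Proof. by rewrite /slope /front_slope (derive1_translate x_n) (derive1_translate y_n). Qed.

Lemma height_n t : z (t + n%:R) = z t.
Proof. by rewrite (height_slope _).2 slope_n -(height_slope _).2. Qed.

(** The slides follow the anti-diagonals, on which the azimuth is constant, so
    each vertex keeps the azimuth of its box center. *)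
Lemma vertex_phase i : P * (V i).1 + - P * (V i).2 = 2 * pi * i%:R.
Proof.
have -> : (i%:R : R) = (minn i h)%:R + (i - h)%:R.
  by rewrite -natrD minnE subnK// leq_subr.
by rewrite /V /vertex /box_center /=; field.
Qed.

Section Segment.
Context (i : nat) (i_n : (i < n)%N).
Let m := seg_slope V i.

Let den : (V i.+1).1 - (V i).1 != 0.
Proof.
apply/eqP => E; have := seg_neg i_n.
by rewrite /seg_slope E invr0 mulr0 ltxx.
Qed.

Lemma segment_ratio t : i%:R + eta <= t <= i.+1%:R - eta ->
  exists2 l : R, 0 <= l <= 1 &
    [/\ x t = (V i).1 + l * ((V i.+1).1 - (V i).1),
        y t = (V i).2 + l * ((V i.+1).2 - (V i).2)
      & phi t = 2 * pi * (i%:R + l)].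
Proof.
move=> it; have [|l l01 [xE yE]] := g_seg i_n (t := t); first by rewrite in_itv.
exists l => //.
have {}xE : x t = (V i).1 + l * ((V i.+1).1 - (V i).1) by rewrite /x /= xE; ring.
have {}yE : y t = (V i).2 + l * ((V i.+1).2 - (V i).2) by rewrite /y /= yE; ring.
split=> //; have V0 := vertex_phase i; have V1 := vertex_phase i.+1.
rewrite /phi /knot_phase xE yE.
transitivity ((1 - l) * (P * (V i).1 + - P * (V i).2) +
  l * (P * (V i.+1).1 + - P * (V i.+1).2)); first by ring.
by rewrite V0 V1 -natr1; ring.
Qed.

Lemma segment_line t : i%:R + eta <= t <= i.+1%:R - eta ->
  y t - (V i).2 = m * (x t - (V i).1) /\ y t - (V i.+1).2 = m * (x t - (V i.+1).1).
Proof.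
move=> /segment_ratio[l _ [-> -> _]].
have E : (V i.+1).2 - (V i).2 = m * ((V i.+1).1 - (V i).1) by rewrite divfK.
split; first by rewrite E; ring.
transitivity ((l - 1) * ((V i.+1).2 - (V i).2)); first by ring.
by rewrite E; ring.
Qed.

Lemma segment_slope t : i%:R + eta <= t <= i.+1%:R - eta -> slope t = m.
Proof.
move=> it; rewrite /slope /front_slope.
have -> : derive1 (th2 \o g) t = m * derive1 (th1 \o g) t.
  have ab : i%:R + eta < i.+1%:R - eta.
    by rewrite -natr1; have := eta01; lra.
  apply: (affine_derive1 (c := (V i).2 - m * (V i).1) dx dy cdx cdy ab _ it) => u iu.
  by rewrite addrCA -mulrBr -(segment_line iu).1 addrCA subrr addr0.
by rewrite mulfK// gt_eqF.
Qed.

End Segment.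

Lemma arc_phase i t : (i < n)%N -> i%:R - eta <= t <= i%:R + eta ->
  `|phi t - 2 * pi * i%:R| < 8^-1.
Proof.
move=> i_n it; have [|xV yV] := g_arc i_n (t := t); first by rewrite in_itv.
have {}xV : `|x t - (V i).1| < e := xV; have {}yV : `|y t - (V i).2| < e := yV.
have -> : phi t - 2 * pi * i%:R = P * ((x t - (V i).1) - (y t - (V i).2)).
  by rewrite -vertex_phase /phi /knot_phase; ring.
have pe' : P * e = 16^-1 := pe.
rewrite normrM gtr0_norm//; have nB := ler_normB (x t - (V i).1) (y t - (V i).2).
have : P * `|x t - (V i).1 - (y t - (V i).2)| < P * (2 * e).
  by rewrite ltr_pM2l// mulr_natl mulr2n; apply: le_lt_trans nB _; exact: ltrD.
lra.
Qed.

Lemma slopes_decr i j : (i < j < n)%N -> seg_slope V j < seg_slope V i.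
Proof.
elim: j => [|j IH]; first by rewrite ltn0.
rewrite ltnS leq_eqVlt => /andP[/predU1P[->|ij] jn]; first exact: seg_decr.
by apply: lt_trans (seg_decr jn) (IH _); rewrite ij ltnW.
Qed.

Lemma vertex_n : (V n).1 = (V 0%N).1 + 2 * pi * h%:R / p%:R /\
  (V n).2 = (V 0%N).2 - 2 * pi * v%:R / p%:R.
Proof.
rewrite /V /vertex /box_center /= s_n /n addnC addnK min0n sub0n.
by rewrite (minn_idPr (leq_addl v h)); split; ring.
Qed.

(** The bend around the last vertex is the translate of that around the first. *)
Lemma arc_before i : (i < n)%N -> 2 * pi * i.+1%:R - 8^-1 < phi (i.+1%:R - eta).
Proof.
have := eta01 => eta_; rewrite leq_eqVlt => /predU1P[->|i_n].
  have -> : n%:R - eta = 0%:R - eta + n%:R by ring.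
  rewrite phase_n -/phi.
  have : `|phi (0%:R - eta) - 2 * pi * 0%:R| < 8^-1 by apply: arc_phase => //; lra.
  by rewrite mulr0 ltr_norml; lra.
have : `|phi (i.+1%:R - eta) - 2 * pi * i.+1%:R| < 8^-1 by apply: arc_phase => //; lra.
by rewrite ltr_norml; lra.
Qed.

Section Nearby.

Let convex_lt a b (l : R) : 0 <= l <= 1 -> `|a| < e -> `|b| < e ->
  `|(1 - l) * a + l * b| < e.
Proof.
move=> l01 ae be; have M_lt : Num.max `|a| `|b| < e by rewrite gt_max ae.
apply: le_lt_trans M_lt; set M := Num.max _ _.
have aM : `|a| <= M by rewrite le_max lexx.
have bM : `|b| <= M by rewrite le_max lexx orbT.
have [l0 l1] := andP l01; have l1' : 0 <= 1 - l by rewrite subr_ge0.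
apply: le_trans (ler_normD _ _) _; rewrite !normrM (ger0_norm l0) (ger0_norm l1').
have -> : M = (1 - l) * M + l * M by ring.
by apply: lerD; apply: ler_wpM2l.
Qed.

Let center_step i :
  `|P * ((box_center p h i.+1).1 - (box_center p h i).1) : R| <= 2 * pi /\
  `|P * ((box_center p h i.+1).2 - (box_center p h i).2) : R| <= 2 * pi.
Proof.
have pi0 := @pi_gt0 R; rewrite /box_center /=.
have -> : P * (pi / p%:R + 2 * pi * (minn i.+1 h)%:R / p%:R -
    (pi / p%:R + 2 * pi * (minn i h)%:R / p%:R)) =
    2 * pi * ((minn i.+1 h)%:R - (minn i h)%:R) by field.
have -> : P * (pi / p%:R - 2 * pi * (i.+1 - h)%:R / p%:R -
    (pi / p%:R - 2 * pi * (i - h)%:R / p%:R)) =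
    - (2 * pi * ((i.+1 - h)%:R - (i - h)%:R)) by field.
rewrite !ler_norml; have [ih|hi] := leqP i.+1 h.
  rewrite (minn_idPl (ltnW ih)).
  move: (ih); rewrite -subn_eq0 => /eqP->.
  by move: (ltnW ih); rewrite -subn_eq0 => /eqP->; rewrite -natr1; lra.
have hi' : (h <= i)%N by rewrite -ltnS.
rewrite (minn_idPr hi') subSn//.
by rewrite -natr1; lra.
Qed.

Let near_lt1 (d l u W : R) : 0 <= l <= 1 -> 2 * pi * l < 8^-1 -> `|W| <= 2 * pi ->
  `|P * d| < 16^-1 -> u = l * W + P * d -> `|u| < 1.
Proof.
rewrite ler_norml => /andP[l0 _] l8 /andP[W1 W2] d16 ->.
have := ler_wpM2l l0 W1; have := ler_wpM2l l0 W2; move: d16.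
by rewrite !ltr_norml; lra.
Qed.

Let ratio_start (j l u : R) : u = 2 * pi * (j + l) -> `|u - 2 * pi * j| < 8^-1 ->
  2 * pi * l < 8^-1.
Proof. by move=> ->; rewrite ltr_norml; lra. Qed.

Let ratio_end (j l u : R) : u = 2 * pi * (j + l) ->
  `|u - 2 * pi * (j + 1)| < 8^-1 -> 2 * pi * (1 - l) < 8^-1.
Proof. by move=> ->; rewrite ltr_norml; lra. Qed.

Let lt8V1 : 8^-1 < 1 :> R.
Proof. by rewrite invf_lt1 ?ltr1n. Qed.

Lemma arc_near i t : (i < n)%N -> i%:R - eta <= t <= i%:R + eta ->
  `|P * (x t - (box_center p h i).1)| < 8^-1 /\
  `|P * (y t - (box_center p h i).2)| < 8^-1.
Proof.
move=> i_n it; have [|xV yV] := g_arc i_n (t := t); first by rewrite in_itv.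
have pe' : P * e = 16^-1 := pe; have se := s_lt (ltnW i_n).
have near u c : `|u - (c + s i)| < e -> `|P * (u - c)| < 8^-1.
  move=> uc; rewrite normrM gtr0_norm//.
  have : P * `|u - c| < P * (2 * e).
    rewrite ltr_pM2l// mulr_natl mulr2n; apply: le_lt_trans (ltrD uc se).
    by apply: le_trans (ler_normD _ _); rewrite opprD addrA subrK.
  by rewrite mulrCA pe'; lra.
by split; apply: near; [exact: xV|exact: yV].
Qed.

(** The slid vertices are close to the box centers, hence so are the points of
    the front whose azimuth is close to that of a vertex. *)
Lemma near_center i t : (0 < i < n)%N -> `|phi t - 2 * pi * i%:R| < 8^-1 ->
  `|P * (x t - (box_center p h i).1)| < 1 /\ `|P * (y t - (box_center p h i).2)| < 1.
Proof.
case: i => // i /andP[_ i_n] phit; have := eta01 => eta_; have pi2 := @pi_ge2 R.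
have i_n' : (i < n)%N := ltnW i_n.
have pe' : P * e = 16^-1 := pe.
have slide j : (j <= n)%N -> `|s j| < e := @s_lt j.
have seg j : (j < n)%N -> j%:R + eta <= t <= j.+1%:R - eta ->
    exists2 l : R, 0 <= l <= 1 & [/\ phi t = 2 * pi * (j%:R + l),
      exists2 d, `|P * d| < 16^-1 &
        x t = (1 - l) * (box_center p h j).1 + l * (box_center p h j.+1).1 + d &
      exists2 d, `|P * d| < 16^-1 &
        y t = (1 - l) * (box_center p h j).2 + l * (box_center p h j.+1).2 + d].
  move=> j_n /(segment_ratio j_n)[l l01 [xE yE phiE]]; exists l => //.
  have Pd : `|P * ((1 - l) * s j + l * s j.+1)| < 16^-1.
    rewrite normrM gtr0_norm// -pe' ltr_pM2l//.
    by apply: convex_lt => //; apply: slide; [exact: ltnW|].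
  split=> //; exists ((1 - l) * s j + l * s j.+1) => //.
    by rewrite xE /V /vertex /=; ring.
  by rewrite yE /V /vertex /=; ring.
have lo : i%:R + eta <= t.
  rewrite leNgt; apply/negP => /phase_lt; rewrite -/phi.
  have : `|phi (i%:R + eta) - 2 * pi * i%:R| < 8^-1 by apply: arc_phase => //; lra.
  rewrite ltr_norml in phit; rewrite ltr_norml.
  by rewrite -(natr1 i) in phit; lra.
have hi : t <= i.+2%:R - eta.
  rewrite leNgt; apply/negP => /phase_lt; rewrite -/phi.
  have := arc_before i_n; rewrite ltr_norml in phit.
  by rewrite -(natr1 i.+1); lra.
have [cs1 cs2] := center_step i; have [cs1' cs2'] := center_step i.+1.
have [t1|t1] := leP t (i.+1%:R - eta).
  have [|l l01 [phiE [d dP xE] [d' d'P yE]]] := seg i i_n' _; first by rewrite lo.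
  have l8 := ratio_end phiE; rewrite natr1 in l8; have {}l8 := l8 phit.
  have l01' : 0 <= 1 - l <= 1 by rewrite subr_ge0 lerBlDr lerDl andbC.
  split.
    apply: (near_lt1 (d := d)
      (W := - (P * ((box_center p h i.+1).1 - (box_center p h i).1))) l01' l8) => //.
      by rewrite normrN.
    by rewrite xE; ring.
  apply: (near_lt1 (d := d')
    (W := - (P * ((box_center p h i.+1).2 - (box_center p h i).2))) l01' l8) => //.
    by rewrite normrN.
  by rewrite yE; ring.
have [t2|t2] := leP t (i.+1%:R + eta); last first.
  have [|l l01 [phiE [d dP xE] [d' d'P yE]]] := seg i.+1 i_n _.
    by rewrite hi ltW.
  have l8 := ratio_start phiE phit.
  split.
    apply: (near_lt1 (d := d) l01 l8 cs1') => //.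
    by rewrite xE; ring.
  apply: (near_lt1 (d := d') l01 l8 cs2') => //.
  by rewrite yE; ring.
have [|xn yn] := @arc_near i.+1 t i_n; first by rewrite t2 ltW.
by split; [exact: lt_trans xn lt8V1|exact: lt_trans yn lt8V1].
Qed.

End Nearby.

Section Strands.
Context (tau : R -> R) (ctau : continuous tau) (tauK : forall u, phi (tau u) = u).

Let le_phi : {mono phi : a b / a <= b}.
Proof. by apply: le_mono => a b; exact: phase_lt. Qed.

Let lt_phi : {mono phi : a b / a < b}.
Proof. exact: leW_mono. Qed.

(** The [i]-th passage of the knot around the sphere, with longitudes measured from
    that of the [i]-th vertex. *)
Definition knot_strand (i : nat) (psi : R) : R := z (tau (2 * pi * i%:R + psi)).

(** Were the bend to start or to end at the vertex itself, both its ends would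
    lie on the line of one of the two segments; by the mean value theorem the
    slope of that segment would be taken inside the bend too. *)
Lemma bend_avoids_vertex (t0 X Y ma mb : R) :
  y (t0 - eta) - Y = ma * (x (t0 - eta) - X) ->
  y (t0 + eta) - Y = mb * (x (t0 + eta) - X) ->
  slope (t0 - eta) = ma -> slope (t0 + eta) = mb ->
  strictly_monotone_on (t0 - eta) (t0 + eta) slope ->
  phi (t0 - eta) <> P * X + - P * Y /\ phi (t0 + eta) <> P * X + - P * Y.
Proof.
have := eta01 => eta_ la lb sa sb mono.
have ab : t0 - eta < t0 + eta by lra.
have vtx t m : slope t = m -> y t - Y = m * (x t - X) ->
    phi t = P * X + - P * Y -> x t = X /\ y t = Y.
  move=> st lt phit; have m0 : m < 0 by rewrite -st; case: (height_slope t).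
  have E : P * ((1 - m) * (x t - X)) = 0.
    by rewrite mulrBl mul1r -lt -[RHS](subrr (phi t)) {2}phit /phi /knot_phase; ring.
  move/eqP: E; rewrite !mulf_eq0 (negbTE Pn0) subr_eq0 gt_eqF/=; last by lra.
  rewrite subr_eq0 => /eqP xE; split=> //.
  by apply: subr0_eq; rewrite lt xE subrr mulr0.
have no_chord m : (m = slope (t0 - eta) \/ m = slope (t0 + eta)) ->
    y (t0 + eta) - y (t0 - eta) = m * (x (t0 + eta) - x (t0 - eta)) -> False.
  move=> mE chord.
  have dG t : derivable (fun t => 1 * y t + - m * x t) t 1 by exact: derivable_comb.
  have [c cab E] := mean_value dG ab.
  rewrite derive1_comb// in E.
  have x0 : derive1 x c != 0 by rewrite gt_eqF.
  have yx : derive1 y c = m * derive1 x c.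
    have : (1 * derive1 y c + - m * derive1 x c) * (t0 + eta - (t0 - eta)) = 0.
      rewrite -E; transitivity (y (t0 + eta) - y (t0 - eta) -
        m * (x (t0 + eta) - x (t0 - eta))); first by ring.
      by rewrite chord subrr.
    move/eqP; rewrite mulf_eq0 => /orP[|] /eqP E0; last by lra.
    by apply: subr0_eq; rewrite -E0; ring.
  have sc : slope c = m by rewrite /slope /front_slope yx mulfK.
  have inab t : t0 - eta <= t <= t0 + eta -> t \in `[t0 - eta, t0 + eta].
    by rewrite in_itv.
  have [ac cb] := andP cab.
  have ca : c \in `[t0 - eta, t0 + eta] by apply: inab; rewrite !ltW.
  have aa : t0 - eta \in `[t0 - eta, t0 + eta] by apply: inab; rewrite lexx ltW.
  have bb : t0 + eta \in `[t0 - eta, t0 + eta] by apply: inab; rewrite lexx ltW.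
  by case: mono => mono; have := mono _ _ aa ca ac; have := mono _ _ ca bb cb;
    rewrite sc; case: mE => ->; rewrite ltxx.
split=> E.
  have [xa ya] := vtx _ _ sa la E.
  by apply: (no_chord mb); [right|rewrite xa ya].
have [xb yb] := vtx _ _ sb lb E; apply: (no_chord ma); first by left.
by rewrite xb yb -opprB la; ring.
Qed.

Lemma corner_ramp (t0 X Y ma mb : R) (Phi := P * X + - P * Y) :
  (forall t, t0 - 1 + eta <= t <= t0 - eta -> slope t = ma) ->
  (forall t, t0 + eta <= t <= t0 + 1 - eta -> slope t = mb) ->
  y (t0 - eta) - Y = ma * (x (t0 - eta) - X) ->
  y (t0 + eta) - Y = mb * (x (t0 + eta) - X) ->
  phi (t0 - eta) <= Phi <= phi (t0 + eta) ->
  phi (t0 - 1 + eta) <= Phi - pi < phi (t0 - eta) ->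
  phi (t0 + eta) < Phi + pi <= phi (t0 + 1 - eta) ->
  strictly_monotone_on (t0 - eta) (t0 + eta) slope ->
  ramp (slope_height ma) (slope_height mb) (fun psi => z (tau (Phi + psi))).
Proof.
have := eta01 => eta_ sa sb la lb Phi_ PhiN PhiP mono.
have sma : slope (t0 - eta) = ma by apply: sa; lra.
have smb : slope (t0 + eta) = mb by apply: sb; lra.
have [nea neb] := bend_avoids_vertex la lb sma smb mono.
split.
  move=> psi; apply: (@continuous_comp _ _ _ (fun psi => tau (Phi + psi)) z).
    apply: (@continuous_comp _ _ _ (fun psi => Phi + psi) tau).
      by apply: cvgD; [exact: cvg_cst|exact: cvg_id].
    exact: ctau.
  exact: height_continuous.
have tau_in (a b u : R) : phi a <= u <= phi b -> a <= tau u <= b.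
  by rewrite -[a <= _]le_phi -[_ <= b]le_phi tauK.
exists (phi (t0 - eta) - Phi), (phi (t0 + eta) - Phi); split.
- have : phi (t0 - eta) != Phi by apply/eqP.
  by rewrite neq_lt => /orP[]; lra.
- have : phi (t0 + eta) != Phi by apply/eqP.
  by rewrite neq_lt => /orP[]; lra.
- move=> psi psi_; rewrite (height_slope _).2 sa//; apply: tau_in; lra.
- move=> psi psi_; rewrite (height_slope _).2 sb//; apply: tau_in; lra.
have slope0 t : slope t < 0 by case: (height_slope t).
have zE t : z t = slope_height (slope t) by case: (height_slope t).
have tau_lt a b : a < b -> tau a < tau b by rewrite -{1}[a]tauK -{1}[b]tauK lt_phi.
have tau_arc psi : psi \in `[phi (t0 - eta) - Phi, phi (t0 + eta) - Phi] ->
    tau (Phi + psi) \in `[t0 - eta, t0 + eta].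
  by rewrite !in_itv /= => psi_; apply: tau_in; lra.
case: mono => mono; [right|left] => a b /tau_arc aI /tau_arc bI ab /=.
  by rewrite !zE slope_height_lt// mono// tau_lt// ltrD2l.
by rewrite !zE slope_height_lt// mono// tau_lt// ltrD2l.
Qed.

Theorem knot_braid : braid n (fun i => slope_height (seg_slope V i)) knot_strand.
Proof.
have := eta01 => eta_; have pi2 := @pi_ge2 R.
have arc i : (i < n)%N -> (- 8^-1 < phi (i%:R - eta) - 2 * pi * i%:R < 8^-1) /\
    (- 8^-1 < phi (i%:R + eta) - 2 * pi * i%:R < 8^-1).
  by move=> i_n; rewrite -!ltr_norml; split; apply: arc_phase => //; lra.
have out i : (i < n)%N -> 2 * pi * i%:R <= phi (i%:R + eta) /\
    phi (i.+1%:R - eta) <= 2 * pi * i.+1%:R.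
  move=> i_n; split.
    have [|l l01 [_ _ ->]] := @segment_ratio i i_n (i%:R + eta).
      by rewrite -natr1; lra.
    by rewrite ler_pM2l; lra.
  have [|l l01 [_ _ ->]] := @segment_ratio i i_n (i.+1%:R - eta).
    by rewrite -natr1; lra.
  by rewrite -natr1 ler_pM2l; lra.
have n_pred : n.-1.+1 = n by rewrite prednK.
have pred_n : (n.-1 < n)%N by rewrite n_pred.
have nE : n.-1%:R = n%:R - 1 :> R by rewrite -[in RHS]n_pred -natr1 addrK.
have phi_n t : phi (t + n%:R) = phi t + 2 * pi * n%:R := phase_n t.
have next := arc_before.
split => //.
- by move=> i j ij; apply: slope_height_lt; [apply: seg_neg; lia|exact: slopes_decr].
- by move=> i i_n; apply: slope_height_range; exact: seg_neg.
- have [xn yn] := vertex_n.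
  have := @corner_ramp 0 (V 0%N).1 (V 0%N).2 (seg_slope V n.-1) (seg_slope V 0%N).
  have [arc0 arc0'] := arc 0%N n0; have [arcn arcn'] := arc n.-1 pred_n.
  have [out0 _] := out 0%N n0; have [_ outn] := out n.-1 pred_n.
  have next0 := next 0%N n0.
  rewrite !(mulr0n, mulr1n, mulr0, subr0) in arc0 arc0' out0 next0.
  rewrite n_pred in outn; rewrite nE in arcn'.
  have phin : phi (n%:R - eta) = phi (0 - eta) + 2 * pi * n%:R.
    by rewrite -phi_n; congr phi; ring.
  have phin' : phi (n%:R - 1 + eta) = phi (0 - 1 + eta) + 2 * pi * n%:R.
    by rewrite -phi_n; congr phi; ring.
  rewrite phin in outn; rewrite phin' in arcn'.
  rewrite vertex_phase; apply.
  + move=> t t_; rewrite -slope_n; apply: segment_slope => //.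
    by rewrite n_pred nE; lra.
  + by move=> t t_; apply: segment_slope => //; lra.
  + have [|_] := @segment_line n.-1 pred_n (0 - eta + n%:R).
      by rewrite n_pred nE; lra.
    have -> : x (0 - eta + n%:R) = x (0 - eta) + 2 * pi * h%:R / p%:R := x_n _.
    have -> : y (0 - eta + n%:R) = y (0 - eta) - 2 * pi * v%:R / p%:R := y_n _.
    rewrite n_pred xn yn => E.
    transitivity (y (0 - eta) - 2 * pi * v%:R / p%:R -
      ((V 0%N).2 - 2 * pi * v%:R / p%:R)); first by ring.
    by rewrite E; ring.
  + by apply: (segment_line n0 _).1; lra.
  + by rewrite mulr0; lra.
  + by rewrite mulr0; lra.
  + rewrite mulr0 (_ : 0 + 1 - eta = 1 - eta); lra.
  + by have := slope_arc n0.
- case=> // j /= j_n.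
  have j_n' : (j < n)%N by exact: ltnW.
  have E : j.+1%:R - 1 = j%:R :> R by rewrite -natr1 addrK.
  have := @corner_ramp j.+1%:R (V j.+1).1 (V j.+1).2 (seg_slope V j) (seg_slope V j.+1).
  rewrite vertex_phase; apply.
  + by move=> t t_; apply: segment_slope => //; lra.
  + by move=> t t_; apply: segment_slope => //; rewrite -(natr1 j.+1); lra.
  + by apply: (segment_line j_n' _).2; lra.
  + by apply: (segment_line j_n _).1; rewrite -(natr1 j.+1); lra.
  + by have [_ ->] := out j j_n'; have [-> _] := out j.+1 j_n.
  + rewrite E; have [_ aj] := arc j j_n'; have [aj' _] := arc j.+1 j_n.
    have jE : 2 * pi * j.+1%:R = 2 * pi * j%:R + 2 * pi :> R by rewrite -natr1; ring.
    by rewrite jE in aj' *; lra.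
  + have [_ aj] := arc j.+1 j_n; have nj := next j.+1 j_n.
    have jE : 2 * pi * j.+2%:R = 2 * pi * j.+1%:R + 2 * pi :> R by rewrite -natr1; ring.
    by rewrite jE -(natr1 j.+1) in nj; lra.
  + exact: slope_arc.
Qed.

Section LensPoints.
Context (q : nat) (q0 : (0 < q)%N) (cop : coprime q p).
Context (gcd1 : gcdn (q - 1) p = 1%N) (hv_p : (n < p)%N) (p_hvq : (p %| h + v * q)%N).

Definition knot_point (u : R) : set (R[i] * R[i]) := lens_pt p q (g (tau u)).

Let on_sphere t : on_S3 (g t).
Proof. by case: leg => _ /(_ t)[]. Qed.

Let r_pos t : 0 < r1 (g t) /\ 0 < r2 (g t).
Proof. by case: leg => _ /(_ t)[]. Qed.

Let r_sum t : r1 (g t) ^+ 2 + r2 (g t) ^+ 2 = 1.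
Proof. by case: (on_sphere t). Qed.

Lemma lag_knot_point u : lag p q (knot_point u) = sphere_pt u (z (tau u)).
Proof.
rewrite lagE//; set t := tau u.
have az : azimuth p q (g t) = u.
  by rewrite /azimuth gcd1 divn1 -[RHS]tauK /phi /knot_phase /x /y /P /= -/t; ring.
have rr : Num.sqrt (1 - z t ^+ 2) = 2 * r1 (g t) * r2 (g t).
  have [r10 r20] := r_pos t.
  have -> : 1 - z t ^+ 2 = (2 * r1 (g t) * r2 (g t)) ^+ 2.
    transitivity ((r1 (g t) ^+ 2 + r2 (g t) ^+ 2) ^+ 2 - z t ^+ 2).
      by rewrite r_sum expr1n.
    by rewrite /z /knot_height; ring.
  by rewrite sqrtr_sqr ger0_norm// !mulr_ge0// ltW.
by rewrite /lag_pt /sphere_pt az rr.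
Qed.

Let r_n t : r1 (g (t + n%:R)) = r1 (g t) /\ r2 (g (t + n%:R)) = r2 (g t).
Proof.
have zn : r1 (g (t + n%:R)) ^+ 2 - r2 (g (t + n%:R)) ^+ 2 =
  r1 (g t) ^+ 2 - r2 (g t) ^+ 2 := height_n t.
have [a1 a2] := r_pos t; have [b1 b2] := r_pos (t + n%:R).
have := r_sum t; have := r_sum (t + n%:R) => s1 s2.
by split; apply/eqP; rewrite -(@eqrXn2 _ 2) ?ltW//; apply/eqP; lra.
Qed.

(** One period of the knot is the deck transformation [F_{p,q}^(-v)]. *)
Lemma knot_point_n t : lens_pt p q (g (t + n%:R)) = lens_pt p q (g t).
Proof.
have [c cE] := dvdnP p_hvq; have [r1n r2n] := r_n t.
have cR : h%:R = c%:R * P - v%:R * q%:R.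
  by rewrite /P -!natrM -cE natrD addrK.
have v_p : (v <= p)%N by apply: leq_trans (ltnW hv_p); rewrite leq_addl.
apply/seteqP; split => _ [j _ <-]; rewrite iter_deck.
  exists (j + (p - v))%N => //; rewrite iter_deck; apply/esym.
  rewrite r1n r2n; apply: (@toC2_mod2pi _ _ _ _ _ _ _ (c%:Z - q%:Z) (-1)).
    by rewrite x_n cR natrD natrB// rmorphB /=; field.
  by rewrite y_n natrD natrB//; field.
exists (j + v)%N => //; rewrite iter_deck.
rewrite r1n r2n; apply: (@toC2_mod2pi _ _ _ _ _ _ _ c%:Z 0).
  by rewrite x_n cR natrD; field.
by rewrite y_n natrD mul0r; field.
Qed.

Lemma lens_pt_angles t t' : lens_pt p q (g t) = lens_pt p q (g t') ->
  exists (j : nat) (k l : int),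
    P * (x t' - x t) = 2 * pi * (j%:Z * q%:Z + k * p%:Z)%:~R /\
    P * (y t' - y t) = 2 * pi * (j%:Z + l * p%:Z)%:~R.
Proof.
move=> E; have : lens_pt p q (g t') (toC2 (g t')) by exists 0%N.
rewrite -E => -[j _]; rewrite iter_deck.
have [a1 a2] := r_pos t; have [b1 b2] := r_pos t'.
case=> ec1 es1 ec2 es2.
have [k kE] := polar_angle_uniq a1 b1 ec1 es1.
have [l lE] := polar_angle_uniq a2 b2 ec2 es2.
exists j, k, l; rewrite /x /y /= kE lE !(rmorphD, rmorphM) /=.
by split; field.
Qed.

(** At a crossing the descending strand is inside its bend, hence the longitude is
    close to that of a vertex, and the two points over it are close to the centers
    of Box 0 and of another box; but a deck transformation that maps one to the
    other would map box centers to box centers. *)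
Lemma knot_point_neq k c : (0 < k < n)%N -> - pi < c < pi ->
  knot_strand 0%N c = knot_strand k c ->
  knot_point (2 * pi * 0%:R + c) <> knot_point (2 * pi * k%:R + c).
Proof.
move=> k_n c_pi cE; have := eta01 => eta_; have pi2 := @pi_ge2 R.
have c_pi' : - pi <= c <= pi by lra.
have /andP[H0 Hn] := crossing_height knot_braid k_n c_pi' cE.
rewrite /knot_point; rewrite /knot_strand in H0 Hn.
have := tauK (2 * pi * 0%:R + c); have := tauK (2 * pi * k%:R + c).
move: (tau _) H0 Hn; set t' := tau _ => t H0 Hn phit' phit.
have zE u : z u = slope_height (slope u) by case: (height_slope u).
have n_pred : n.-1.+1 = n by rewrite prednK.
have pred_n : (n.-1 < n)%N by rewrite n_pred.
have nE : n.-1%:R = n%:R - 1 :> R by rewrite -[in RHS]n_pred -natr1 addrK.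
(* outside the bend around vertex 0 the descending strand is at an end height *)
have t_le : t <= eta.
  rewrite leNgt; apply/negP => lt_t.
  have t_lt : t < 1 - eta by rewrite -lt_phi phit; have := arc_before n0; lra.
  move: H0; rewrite zE (@segment_slope 0%N n0) ?ltxx//; lra.
have t_ge : - eta <= t.
  rewrite leNgt; apply/negP => lt_t.
  have arcn : `|phi (n.-1%:R + eta) - 2 * pi * n.-1%:R| < 8^-1.
    by apply: arc_phase => //; lra.
  have t_gt : n.-1%:R + eta < t + n%:R.
    by rewrite -lt_phi phase_n phit; rewrite ltr_norml nE in arcn; rewrite nE; lra.
  move: Hn; rewrite -(height_n t) zE (@segment_slope n.-1 pred_n) ?ltxx//.
  by rewrite n_pred; lra.
have t_arc : 0%:R - eta <= t <= 0%:R + eta by lra.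
have := arc_phase n0 t_arc; rewrite phit mulr0 add0r subr0 => c8.
have [xt yt] := arc_near n0 t_arc.
have [|xt' yt'] := @near_center k t' k_n.
  by rewrite phit' [_ + c]addrC addrK.
move=> /lens_pt_angles[j [k1 [l [xE yE]]]].
have center i : P * (box_center p h i).1 = pi + 2 * pi * (minn i h)%:R :> R /\
    P * (box_center p h i).2 = pi - 2 * pi * (i - h)%:R :> R.
  by rewrite /box_center /=; split; field.
have [ck1 ck2] := center k; have [c01 c02] := center 0%N.
rewrite min0n sub0n in c01 c02; rewrite !ltr_norml in xt yt xt' yt'.
(* the error on each side is below half the spacing [2 pi / p] of the centers *)
have k1E : j%:Z * q%:Z + k1 * p%:Z - (minn k h)%:Z = 0.
  by apply: (@int_small R); rewrite rmorphB /= mulrBr -xE ltr_norml; lra.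
have lE : j%:Z + l * p%:Z + (k - h)%:Z = 0.
  by apply: (@int_small R); rewrite rmorphD /= mulrDr -yE ltr_norml; lra.
have /negP := path_center_neq0 cop hv_p p_hvq k_n; apply.
have : (p%:Z %| (minn k h + (k - h) * q)%:Z)%Z.
  apply/dvdzP; exists (k1 - l * q%:Z).
  have khE : (k - h)%:Z = - (j%:Z + l * p%:Z).
    by apply/eqP; rewrite -addr_eq0 addrC lE.
  rewrite PoszD PoszM khE -(subr0_eq k1E); ring.
by [].
Qed.

Lemma knot_presentation :
  braid_presentation p q n [set lens_pt p q (g t) | t in [set: R]].
Proof.
exists (fun i => slope_height (seg_slope V i)), (fun u => z (tau u)), knot_point.
split.
- exact: knot_braid.
- apply/seteqP; split => _ [t _ <-]; last by exists (tau t).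
  exists (phi t) => //; rewrite /knot_point; congr (lens_pt p q (g _)).
  by apply: (inc_inj le_phi); rewrite tauK.
- exact: lag_knot_point.
- move=> u; rewrite /knot_point -(knot_point_n (tau u)); congr (lens_pt p q (g _)).
  by apply: (inc_inj le_phi); rewrite phase_n -/phi !tauK.
- exact: knot_point_neq.
Qed.

End LensPoints.

End Strands.

End SpecialKnot.

(** * Counting the crossings and the regions *)

Theorem corollary1 (R : realType) (p q h v : nat)
    (lt1q : (1 < q)%N) (ltqp : (q < p)%N) (cop_qp : coprime q p)
    (gridK : grid_one p q h v) (primK : primitive p h)
    (gcd1 : gcdn (q - 1) p = 1%N) :
  exists2 e0 : R, 0 < e0 &
    forall K : set (set (R[i] * R[i])), special_knot p q h v e0 K ->
      let Gamma := lag p q @` K in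
      has_crossings p q K (h + v - 1) /\
      (components (@S2 R `\` Gamma) #= `I_(h + v + 1))%card.
Proof.
have [h0 v0 hv_p p_hvq] := grid_one_bounds cop_qp gridK.
have q0 : (0 < q)%N by exact: ltnW.
have p0 : (0 < p)%N by exact: ltn_trans ltqp.
have P0 : 0 < p%:R :> R by rewrite ltr0n.
exists (16 * p%:R)^-1; first by rewrite invr_gt0 mulr_gt0.
have pe : p%:R * (16 * p%:R)^-1 = 16^-1 :> R by rewrite invfM mulrCA divff ?mulr1// gt_eqF.
move=> K [g [leg [s [eta [[s_n s_lt] [seg_neg seg_decr] eta01 [x_n y_n]
  [x_pos g_seg g_arc slope_arc]]]] ->]].
have n0 : 0 < (h + v)%:R :> R by rewrite ltr0n addn_gt0 h0.
have T0 : 0 < 2 * pi * (h + v)%:R :> R by rewrite !mulr_gt0// pi_gt0.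
have [tau ctau tauK] := increasing_translate_inverse n0 T0
  (phase_continuous leg) (phase_lt p0 leg x_pos) (phase_n p0 x_n y_n).
have present := knot_presentation p0 h0 v0 pe leg eta01 s_n s_lt seg_neg seg_decr
  x_n y_n x_pos g_seg g_arc slope_arc ctau tauK q0 cop_qp gcd1 hv_p p_hvq.
by rewrite /= subn1 addn1; exact: braid_presentation_count present.
Qed.
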